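(* Let $\{(X_n,Y_n):n\ge 1\}$ be independent copies of a random vector $(X,Y)$, where $X$ and $Y$ are mutually independent with continuous distribution functions $G$ and $H$. Let $\{k_n\}_{n\ge1}$ be a sequence of positive constants such that, for all integers $n>1$: $0<k_n\le n$; $k_n\uparrow$ as $n\to\infty$ (monotone nondecreasing); $k_n/n\searrow\gamma$ as $n\to\infty$ (monotone nonincreasing with limit $\gamma$), where $0\le\gamma\le1$; and $k_n/\log_2 n\to\infty$ as $n\to\infty$. Let $\mathbb{G}_n^{*}$ and $\alpha_{n;0}^{*}$ be the processes on $[0,1]^2$ defined in the context. Then, almost surely: (i) when $0<\gamma\le 1/2$, $$\limsup_{n\to\infty} n^{1/2}k_n^{-1/4}(\log_2 n)^{-1/4}(\log_1 n)^{-1/2}\,\|\mathbb{G}_n^{*}-\alpha_{n;0}^{*}\|\le \left[3\times 2^{-1/4}+\gamma 2^{5/4}\right](1-\gamma)^{1/4};$$ (ii) when $1/2<\gamma\le 1$, $$\limsup_{n\to\infty} n^{1/2}k_n^{-1/4}(\log_2 n)^{-1/4}(\log_1 n)^{-1/2}\,\|\mathbb{G}_n^{*}-\alpha_{n;0}^{*}\|\le \left[3\times 2^{-3/4}+\gamma 2^{3/4}\right]\gamma^{-1/4}.$$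
   Context: Notation: $\log_1 u=\log(u\vee e)$ and $\log_p u=\log_1(\log_{p-1}u)$ for $p\ge2$. For a bounded function $f$ on $[0,1]^2$, $\|f\|=\sup_{x\in[0,1]^2}|f(x)|$. Empirical copula process: $\mathbb{F}_n(x,y)=\frac1n\sum_{i=1}^n 1\{X_i\le x,Y_i\le y\}$, $G_n(x)=\frac1n\sum_{i=1}^n1\{X_i\le x\}$, $H_n(y)=\frac1n\sum_{i=1}^n1\{Y_i\le y\}$; empirical quantile functions $G_n^{-1}(u)=\inf\{x:G_n(x)\ge u\}$, $H_n^{-1}(v)=\inf\{y:H_n(y)\ge v\}$ (equal to $-\infty$ at $0$, with $\mathbb{F}_n=0$ whenever one argument is $-\infty$). The empirical copula is $\mathbb{C}_n(u,v)=\mathbb{F}_n(G_n^{-1}(u),H_n^{-1}(v))$, the copula of $(X,Y)$ is $\mathbb{C}(u,v)=uv$, and $\mathbb{G}_n(u,v)=n^{1/2}(\mathbb{C}_n(u,v)-\mathbb{C}(u,v))$ for $(u,v)\in[0,1]^2$. The local process is $$\mathbb{G}_n^{*}(u,v)=\mathbb{G}_n\left(u\tfrac{k_n}{n},v\tfrac{k_n}{n}\right),\quad (u,v)\in[0,1]^2.$$ Uniform empirical processes: $U_i=G(X_i)$, $V_i=H(Y_i)$, $\mathbb{T}_n(u,v)=\frac1n\sum_{i=1}^n1\{U_i\le u,V_i\le v\}$, $\alpha_n(u,v)=n^{1/2}(\mathbb{T}_n(u,v)-uv)$, $\alpha_{n;\mathbb{U}}(u)=\alpha_n(u,1)$, $\alpha_{n;\mathbb{V}}(v)=\alpha_n(1,v)$,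 and $$\alpha_{n;0}^{*}(u,v)=\alpha_n\left(\tfrac{uk_n}{n},\tfrac{vk_n}{n}\right)-u\tfrac{k_n}{n}\,\alpha_{n;\mathbb{V}}\left(v\tfrac{k_n}{n}\right)-v\tfrac{k_n}{n}\,\alpha_{n;\mathbb{U}}\left(u\tfrac{k_n}{n}\right).$$ *)

(* Defs.v *)
From mathcomp Require Import all_boot all_order all_algebra.
From mathcomp Require Import finmap.
From mathcomp Require Import all_classical all_reals all_analysis.

Set Implicit Arguments.
Unset Strict Implicit.
Unset Printing Implicit Defensive.

Import Order.TTheory GRing.Theory Num.Theory.
Import numFieldNormedType.Exports.

Local Open Scope classical_set_scope.
Local Open Scope ring_scope.

Section independence.
Context d (T : measurableType d) (R : realType) (P : probability T R).

Definition independent_RVs d1 (S1 : measurableType d1) d2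
    (S2 : measurableType d2) (X : T -> S1) (Y : T -> S2) : Prop :=
  forall (A : set S1) (B : set S2), measurable A -> measurable B ->
    P ((X @^-1` A) `&` (Y @^-1` B)) = (P (X @^-1` A) * P (Y @^-1` B))%E.

Definition mutually_independent (I : choiceType) d1 (S : measurableType d1)
    (Z : I -> T -> S) : Prop :=
  forall (J : {fset I}) (A : I -> set S), (forall i, measurable (A i)) ->
    P (\bigcap_(i in [set` J]) (Z i @^-1` A i)) =
    (\prod_(i <- J) P (Z i @^-1` A i))%E.

(* Measures are only meaningful on measurable sets, so equality in law is not
   equality of the underlying set functions. *)
Definition same_law d1 (S : measurableType d1) (Z1 Z2 : T -> S) : Prop :=
  forall A : set S, measurable A -> P (Z1 @^-1` A) = P (Z2 @^-1` A).

End independence.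

(* Iterated natural logarithms: the index does not denote a base. *)
Section logarithms.
Context {R : realType}.

Definition log1 (u : R) : R := ln (Num.max u (expR 1)).

Definition log2 (u : R) : R := log1 (log1 u).

End logarithms.

(* Extended-real valued, so that no junk value arises if [f] is unbounded. *)
Definition supnorm {R : realType} (f : R -> R -> R) : \bar R :=
  ereal_sup [set `|f u v|%:E | u in `[0, 1]%classic & v in `[0, 1]%classic].

(* Realizations x, y of the samples X_1, X_2, ... and Y_1, Y_2, ... are indexed
   from 0, so that the first n observations are x i, y i for i < n. *)
Section empirical_copula_process.
Context {R : realType} (n : nat) (x y : nat -> R).

(* The joint empirical distribution function takes extended-real arguments, as
   it is evaluated at the quantile -oo (where it vanishes). *)
Definition ecdf2 (s t : \bar R) : R :=
  n%:R^-1 * \sum_(i < n) (((x i)%:E <= s)%E && ((y i)%:E <= t)%E)%:R.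

Definition ecdf (z : nat -> R) (s : R) : R :=
  n%:R^-1 * \sum_(i < n) (z i <= s)%R%:R.

Definition equantile (z : nat -> R) (u : R) : \bar R :=
  ereal_inf [set s%:E | s in [set s : R | u <= ecdf z s]].

Definition empirical_copula (u v : R) : R :=
  ecdf2 (equantile x u) (equantile y v).

Definition copula_process (u v : R) : R :=
  n%:R `^ 2^-1 * (empirical_copula u v - u * v).

Definition local_copula_process (k u v : R) : R :=
  copula_process (u * (k / n%:R)) (v * (k / n%:R)).

End empirical_copula_process.

(* Here U i = G (X i) and V i = H (Y i). *)
Section uniform_empirical_process.
Context {R : realType} (n : nat) (U V : nat -> R).

Definition uniform_ecdf (u v : R) : R :=
  n%:R^-1 * \sum_(i < n) ((U i <= u) && (V i <= v))%R%:R.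

Definition alpha (u v : R) : R :=
  n%:R `^ 2^-1 * (uniform_ecdf u v - u * v).

Definition alphaU (u : R) : R := alpha u 1.

Definition alphaV (v : R) : R := alpha 1 v.

Definition local_alpha0 (k u v : R) : R :=
  alpha (u * (k / n%:R)) (v * (k / n%:R))
  - u * (k / n%:R) * alphaV (v * (k / n%:R))
  - v * (k / n%:R) * alphaU (u * (k / n%:R)).

End uniform_empirical_process.

Section normalized_error.
Context {R : realType} (k : nat -> R) (G H : R -> R) (x y : nat -> R).

Definition normalized_error (n : nat) : \bar R :=
  ((n%:R `^ 2^-1 * k n `^ (- 4^-1) * log2 n%:R `^ (- 4^-1)
     * log1 n%:R `^ (- 2^-1))%:E
   * supnorm (fun u v => local_copula_process n x y (k n) u v
                       - local_alpha0 n (G \o x) (H \o y) (k n) u v)%R)%E.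

End normalized_error.

(* Main.v *)
(** Put U_i = G(X_i) and V_i = H(Y_i).  The empirical quantiles of orders u and v
    provide a point (a, b) at which the empirical copula is T_n(a, b), and up to
    O(n^(-1/2)) the difference of the two processes at (u, v) is n^(-1/2) times
    the sum over the sample of
      1{U <= a, V <= b} - 1{U <= u, V <= v}
        - u (1{V <= b} - 1{V <= v}) - v (1{U <= a} - 1{U <= u}),
    whose mean is (a - u) (b - v) and whose second moment is at most
      u (1 - u) |b - v| + v (1 - v) |a - u| + 7 |a - u| |b - v|.
    A law of the iterated logarithm with a non-optimal constant bounds |a - u|
    and |b - v| by 1.3 (log log n / n)^(1/2) up to smaller terms; Bernstein's
    inequality and a union bound over a grid of mesh n^(-3/4) then bound the sum
    by a multiple of (n log log n)^(1/4) (log n)^(1/2).  Estimating the whole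
    summand at once, instead of its three parts separately, gains enough to
    absorb both the crude union bound and the non-optimal iterated logarithm.

    At grid points a sample element only matters through the cell, among finitely
    many, in which it falls.  The sample thus becomes a random word over a finite
    alphabet, on which Ville's maximal inequality is elementary. *)

Require Import Defs.
From mathcomp Require Import all_boot all_order all_algebra.
From mathcomp Require Import finmap.
From mathcomp Require Import all_classical all_reals all_analysis.
From mathcomp Require Import measurable_realfun.
From mathcomp Require Import ring lra zify.
Set Implicit Arguments.
Unset Strict Implicit.
Unset Printing Implicit Defensive.
Import Order.TTheory GRing.Theory Num.Theory.
Import numFieldNormedType.Exports.
Local Open Scope classical_set_scope.
Local Open Scope ring_scope.

(** * Covered events *)

(** The quantiles make a and b random, so all pairs (u, a) and (v, b) within the window must be
    controlled at once, and the iterated logarithm is needed uniformly in the level. Let sigma bound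
    u (1 - u) and v (1 - v). With the exponent 36/10 against n^2 quadruples, Bernstein's deviation
    is 2 (0.52 * 2 * 1.31 * 3.6)^(1/2), about 4.43, times sigma^(1/2) (n log log n)^(1/4) (log
    n)^(1/2); rounding errors raise 4.43 to 4.6. Since k_n / n tends to gamma, normalization leaves
    4.6 sigma^(1/2) gamma^(-1/4), where sigma is gamma (1 - gamma), up to one percent, when gamma <=
    1/2, and 1/4 otherwise. For gamma <= 1/2 this lies below the stated bound, but near gamma = 0.23
    by little more than two percent. That margin explains why 13/25 is kept close to 1/2 and why
    each error receives so small an allowance. *)

Section covers.
Context d (T : measurableType d) (R : realType) (P : probability T R).

(* An outer-measure bound: it spares measurability proofs for the bad events. *)
Definition covered (B : set T) (r : R) : Prop :=
  exists E, [/\ measurable E, B `<=` E & (P E <= r%:E)%E].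

Lemma covered_le (B B' : set T) (r r' : R) :
  B `<=` B' -> r' <= r -> covered B' r' -> covered B r.
Proof.
move=> BB' rr' [E [mE BE PE]]; exists E; split => //.
  exact: subset_trans BE.
by rewrite (le_trans PE)// lee_fin.
Qed.

Lemma covered0 (r : R) : 0 <= r -> covered set0 r.
Proof. by move=> r0; exists set0; split => //; rewrite measure0 lee_fin. Qed.

Lemma coveredU (B B' : set T) (r r' : R) :
  covered B r -> covered B' r' -> covered (B `|` B') (r + r').
Proof.
move=> [E [mE BE PE]] [F [mF BF PF]]; exists (E `|` F); split.
- exact: measurableU.
- exact: setUSS.
- by rewrite (le_trans (measureU2 _ mE mF))// EFinD leeD.
Qed.

Lemma covered_fin (I : finType) (B : I -> set T) (r : I -> R) :
  (forall i, covered (B i) (r i)) ->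
  covered (\bigcup_(i in [set: I]) B i) (\sum_i r i).
Proof.
move=> h.
have H : forall s : seq I,
    covered [set w | exists2 i, i \in s & B i w] (\sum_(i <- s) r i).
  elim=> [|i s IH].
    rewrite big_nil; apply: covered_le (covered0 (lexx 0)) => //.
    by move=> w [].
  rewrite big_cons; apply: covered_le (coveredU (h i) IH) => //.
  move=> w [j]; rewrite inE => /orP[/eqP->|js] Bw; [by left|by right; exists j].
apply: covered_le (H (index_enum I)) => //.
by move=> w [i _ Bw]; exists i => //; rewrite mem_index_enum.
Qed.

Lemma covered_card (I : finType) (B : I -> set T) (r : R) :
  (forall i, covered (B i) r) ->
  covered (\bigcup_(i in [set: I]) B i) (#|I|%:R * r).
Proof.
move=> h; apply: covered_le (covered_fin h) => //.
by rewrite sumr_const mulr_natl.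
Qed.

(** Borel-Cantelli for the measurable covers: their limsup is a measurable null set even if the
    [B n] are not measurable. *)
Lemma covered_borel_cantelli (B : nat -> set T) (r : nat -> R) (K : R) n0 :
  (forall n, (n0 <= n)%N -> covered (B n) (r n)) ->
  (forall N, \sum_(n0 <= n < N) r n <= K) ->
  {ae P, forall w, exists n1, forall n, (n1 <= n)%N -> ~ B n w}.
Proof.
move=> cB rK.
(* Covers below [n0] are empty, so the full series is bounded by the sums starting at [n0]. *)
have /choice[E hE] : forall n, exists E, [/\ measurable E,
    (n0 <= n)%N -> B n `<=` E, ((n < n0)%N -> E = set0) &
    (n0 <= n)%N -> (P E <= (r n)%:E)%E].
  move=> n; case: (ltnP n n0) => [ltn|/cB[E [mE BE PE]]].
    by exists set0; split => //.
  by exists E; split.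
exists (lim_sup_set E); split.
- apply: bigcap_measurable => // n _; apply: bigcup_measurable => k _.
  by have [] := hE k.
- apply: lim_sup_set_cvg0 => [k|]; first by have [] := hE k.
  apply: (@le_lt_trans _ _ (K%:E)); last exact: ltry.
  apply: lime_le; first by apply: is_cvg_nneseries => *.
  apply: nearW => N.
  case: (leqP N n0) => Nn0.
    rewrite big_nat big1 => [|i /andP[_ iN]].
      rewrite lee_fin; apply: le_trans (rK n0); rewrite big_geq//.
    have [_ _ Ei0 _] := hE i.
    by rewrite Ei0 ?measure0//; exact: leq_trans iN Nn0.
  rewrite (big_cat_nat (leq0n n0) (ltnW Nn0))/= big_nat big1 ?add0e; last first.
    by move=> i /andP[_ iN]; have [_ _ Ei0 _] := hE i; rewrite Ei0 ?measure0.
  apply: (@le_trans _ _ (\sum_(n0 <= n < N) r n)%:E); last by rewrite lee_fin.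
  rewrite -sumEFin big_nat [leRHS]big_nat; apply: lee_sum => i /andP[ni _].
  by have [_ _ _ ->] := hE i.
- move=> w /= nw n _ /=; apply: contrapT => h; apply: nw.
  exists (maxn n n0) => m mn Bm; apply: h; exists m => /=.
    exact: leq_trans (leq_maxl _ _) mn.
  by have [_ + _ _] := hE m; apply => //; exact: leq_trans (leq_maxr _ _) mn.
Qed.

End covers.

(** * Maximal inequalities *)

Section ville.
Context d (T : measurableType d) (R : realType) (P : probability T R).
Context (F : finType) (W : nat -> T -> F) (p : F -> R).

Definition word_event (s : seq F) : set T :=
  [set w | mkseq (W ^~ w) (size s) = s].

(** Independence and identical distribution of the letters, expressed through the masses of finite
    words. Measurability is included because [ville] uses word events as covers. *)
Definition iid_words : Prop := forall s,
  measurable (word_event s) /\ P (word_event s) = (\prod_(c <- s) p c)%:E.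

Hypothesis hW : iid_words.
Hypothesis p0 : forall c, 0 <= p c.

(* The induction runs over the tree of words: having already read [s], the
   product started at [s] reaches [A] with probability at most its current
   value divided by [A]. *)
Lemma ville (g : F -> R) (A : R) (N : nat) :
  (forall c, 0 <= g c) -> \sum_c p c * g c <= 1 -> 0 < A ->
  covered P [set w | exists2 n, (n <= N)%N & A <= \prod_(i < n) g (W i w)]
    A^-1.
Proof.
move=> g0 g1 A0.
suff H : forall (N : nat) (s : seq F),
    covered P [set w | mkseq (W ^~ w) (size s) = s /\
      exists2 n, (n <= N)%N & A <= \prod_(c <- mkseq (W ^~ w) (size s + n)) g c]
    ((\prod_(c <- s) p c) * (\prod_(c <- s) g c) / A).
  have := H N [::]; rewrite !big_nil !mul1r; apply: covered_le => //.
  move=> w [n nN An] /=; split => //; exists n => //.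
  by rewrite add0n big_map -[n in iota _ n]subn0 -/(index_iota 0 n) big_mkord.
move=> {}N; elim: N => [|N IH] s.
  have [As|As] := leP A (\prod_(c <- s) g c).
    have [mW PW] := hW s.
    exists (word_event s); split => //; first by move=> w [].
    rewrite PW lee_fin -mulrA ler_peMr//; first exact: prodr_ge0.
    by rewrite ler_pdivlMr// mul1r.
  apply: covered_le (covered0 _ (lexx 0)).
    move=> w [ws [n]]; rewrite leqn0 => /eqP ->; rewrite addn0 ws.
    by rewrite leNgt As.
  by rewrite divr_ge0 ?mulr_ge0 ?prodr_ge0// ltW.
have [As|As] := leP A (\prod_(c <- s) g c).
  have [mW PW] := hW s.
  exists (word_event s); split => //; first by move=> w [].
  rewrite PW lee_fin -mulrA ler_peMr//; first exact: prodr_ge0.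
  by rewrite ler_pdivlMr// mul1r.
apply: covered_le (covered_fin (fun c => IH (rcons s c))).
  move=> w [ws [n nN An]].
  case: n nN An => [|n] nN An; first by rewrite addn0 ws leNgt As in An.
  exists (W (size s) w) => //; split; first by rewrite size_rcons mkseqS ws.
  by exists n => //; rewrite size_rcons addSnnS.
rewrite [leLHS](eq_bigr (fun c => ((\prod_(c <- s) p c) * (\prod_(c <- s) g c) / A) *
  (p c * g c))) => [|c _].
  by rewrite -mulr_sumr ler_piMr// divr_ge0 ?mulr_ge0 ?prodr_ge0// ltW.
by rewrite -!cats1 !big_cat/= !big_seq1; ring.
Qed.

End ville.

(** * Bernstein's inequality in maximal form *)

Section bernstein_scalar.
Context (R : realType).

(* 13/25 > 1/2 is affordable, and 1/13 = (2 * 13/25 - 1) / (13/25) is where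
   (1 + y + 13/25 y^2) e^(-y) stops increasing. *)
Lemma expR_le_quad (y : R) :
  y <= 13%:R^-1 -> expR y <= 1 + y + 13%:R / 25%:R * y ^+ 2.
Proof.
move=> y13.
pose f (z : R) := (1 + z + 13%:R / 25%:R * z ^+ 2) * expR (- z).
pose df (z : R) := z * (1/25%:R - 13%:R / 25%:R * z) * expR (- z).
have fE (z : R) : is_derive z 1 f (df z).
  apply: is_derive_eq; rewrite /df /GRing.scale/=. by field.
have cf (z : R) : {for z, continuous f}.
  by apply: differentiable_continuous; apply/derivable1_diffP; exact: ex_derive.
suff : 1 <= f y.
  by rewrite /f expRN ler_pdivlMr ?expR_gt0// mul1r.
have f0 : f 0 = 1 by rewrite /f oppr0 expR0; field.
(* On the half-line up to 1/13, [f] decreases to its value 1 at 0 and increases afterwards. *)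
have [y0|y0] := leP y 0.
  have [c /[!in_itv]/= /andP[yc c0]] := MVT_segment y0 (fun x _ => fE x) 
    (continuous_subspaceT cf).
  rewrite f0 sub0r => E; rewrite -subr_le0 E /df mulrAC.
  rewrite mulr_le0_ge0 ?expR_ge0// mulrAC.
  apply: mulr_le0_ge0; last nra.
  by rewrite mulr_le0_ge0// oppr_ge0.
have [c /[!in_itv]/= /andP[yc c0]] := MVT_segment (ltW y0) (fun x _ => fE x) 
  (continuous_subspaceT cf).
rewrite f0 subr0 => E; rewrite -subr_ge0 E /df.
by rewrite !mulr_ge0 ?expR_ge0//; [nra|exact: ltW].
Qed.

End bernstein_scalar.
Section bernstein.
Context d (T : measurableType d) (R : realType) (P : probability T R).
Context (F : finType) (W : nat -> T -> F) (p : F -> R).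
Hypothesis hW : iid_words P W p.
Hypothesis p0 : forall c, 0 <= p c.
Hypothesis p1 : \sum_c p c = 1.

(** The factors exp(lam f - B) have mean at most 1 because 1 + B <= exp B, so Ville's inequality
    bounds the probability that their product ever reaches exp x. As B >= 0, the drift n B may be
    replaced by N B, which gives one threshold for all n <= N. *)
Lemma bernstein_maximal (f : F -> R) (m s2 lam x : R) (N : nat) :
  0 < lam -> (forall c, lam * f c <= 13%:R^-1) -> 0 <= m -> 0 <= s2 ->
  \sum_c p c * f c <= m -> \sum_c p c * f c ^+ 2 <= s2 ->
  covered P [set w | exists2 n, (n <= N)%N &
     N%:R * (m + 13%:R / 25%:R * lam * s2) + x / lam
       <= \sum_(i < n) f (W i w)] (expR (- x)).
Proof.
move=> lam0 lamf m0 s20 fm fs.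
pose B := lam * m + 13%:R / 25%:R * lam ^+ 2 * s2.
have B0 : 0 <= B.
  by rewrite addr_ge0// !mulr_ge0 ?sqr_ge0 ?invr_ge0 ?ler0n// ltW.
pose g c := expR (lam * f c - B).
have g1 : \sum_c p c * g c <= 1.
  have -> : \sum_c p c * g c = expR (- B) * \sum_c p c * expR (lam * f c).
    rewrite mulr_sumr; apply: eq_bigr => c _; rewrite /g expRD; ring.
  rewrite mulrC expRN ler_pdivrMr ?expR_gt0// mul1r.
  apply: le_trans (expR_ge1Dx B).
  apply: (@le_trans _ _ (\sum_c (p c + lam * (p c * f c)
      + 13%:R / 25%:R * lam ^+ 2 * (p c * f c ^+ 2)))).
    apply: ler_sum => c _.
    apply: le_trans (ler_wpM2l (p0 c) (expR_le_quad (lamf c))) _.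
    by rewrite le_eqVlt; apply/orP; left; apply/eqP; ring.
  rewrite !big_split/= -!mulr_sumr p1 -addrA lerD2l lerD//.
    by rewrite ler_wpM2l// ltW.
  by apply: ler_wpM2l fs; apply: mulr_ge0 (sqr_ge0 _); apply: divr_ge0.
have := @ville _ _ _ _ _ _ _ hW p0 g (expR x) N (fun c => expR_ge0 _) g1
  (expR_gt0 x).
apply: covered_le; last by rewrite expRN.
move=> w [n nN Sn]; exists n => //.
rewrite -expR_sum ler_expR sumrB -mulr_sumr sumr_const card_ord.
rewrite lerBrDr; apply: (@le_trans _ _ (x + N%:R * B)).
  by rewrite lerD2l -[B *+ n]mulr_natl ler_wpM2r// ler_nat.
have -> : x + N%:R * B = lam *
  (N%:R * (m + 13%:R / 25%:R * lam * s2) + x / lam).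
  by rewrite /B; field; rewrite gt_eqF.
by rewrite ler_wpM2l// ltW.
Qed.

(** With V = 13/25 N s2, the choice lam = (x / V)^(1/2) minimizes lam V + x / lam, with value 2 (V
    x)^(1/2). The hypothesis with 169 = 13^2 is the square of lam b <= 1/13. *)
Lemma bernstein_maximal_abs (f : F -> R) (b m s2 x : R) (N : nat) :
  (forall c, `|f c| <= b) -> `|\sum_c p c * f c| <= m ->
  \sum_c p c * f c ^+ 2 <= s2 -> 0 < x -> 0 < N%:R * s2 ->
  169%:R * b ^+ 2 * x <= 13%:R / 25%:R * (N%:R * s2) ->
  covered P [set w | exists2 n, (n <= N)%N &
     N%:R * m + 2%:R * Num.sqrt (13%:R / 25%:R * (N%:R * s2) * x)
       <= `|\sum_(i < n) f (W i w)|] (2%:R * expR (- x)).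
Proof.
move=> fb fm fs x0 Ns0 hx.
have m0 : 0 <= m by apply: le_trans fm.
have s20 : 0 <= s2.
  by apply: le_trans fs; apply: sumr_ge0 => c _; rewrite mulr_ge0 ?sqr_ge0.
set V := 13%:R / 25%:R * (N%:R * s2) in hx *.
have V0 : 0 < V by rewrite mulr_gt0 ?divr_gt0 ?ltr0n.
set y := Num.sqrt V; set z := Num.sqrt x.
have y0 : 0 < y by rewrite sqrtr_gt0.
have z0 : 0 < z by rewrite sqrtr_gt0.
have y2 : y ^+ 2 = V by rewrite sqr_sqrtr// ltW.
have z2 : z ^+ 2 = x by rewrite sqr_sqrtr// ltW.
have lam0 : 0 < z / y by rewrite divr_gt0.
have lamb : z / y * b <= 13%:R^-1.
  rewrite mulrAC ler_pdivrMr// [leRHS]mulrC ler_pdivlMr ?ltr0n//.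
  have [b0|b0] := leP 0 b; last first.
    by apply: le_trans (ltW y0); apply: mulr_le0_ge0 => //; apply: mulr_ge0_le0; exact: ltW.
  rewrite -(@ler_pXn2r _ 2) ?nnegrE ?mulr_ge0 ?(ltW y0) ?(ltW z0)//.
  rewrite !exprMn y2 z2; apply: le_trans hx.
  by rewrite le_eqVlt; apply/orP; left; apply/eqP; ring.
have thr : N%:R * m + 2%:R * Num.sqrt (V * x) =
   N%:R * (m + 13%:R / 25%:R * (z / y) * s2) + x / (z / y).
  rewrite sqrtrM ?ltW// -/y -/z -z2.
  have E : 13%:R / 25%:R * (N%:R * s2) = y ^+ 2 by rewrite y2.
  have -> : N%:R * (m + 13%:R / 25%:R * (z / y) * s2) =
    N%:R * m + 13%:R / 25%:R * (N%:R * s2) * (z / y) by ring.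
  by rewrite E; field; rewrite !gt_eqF.
have c1 := @bernstein_maximal f m s2 (z / y) x N lam0.
have c2 := @bernstein_maximal (fun c => - f c) m s2 (z / y) x N lam0.
rewrite thr; have -> : 2%:R * expR (- x) = expR (- x) + expR (- x) by ring.
have le1 c : z / y * f c <= 13%:R^-1.
  apply: le_trans lamb; rewrite ler_wpM2l ?(ltW lam0)//.
  by rewrite (le_trans (ler_norm _)).
have le2 c : z / y * - f c <= 13%:R^-1.
  apply: le_trans lamb; rewrite ler_wpM2l ?(ltW lam0)//.
  by rewrite (le_trans _ (fb c))// -normrN ler_norm.
have m1 : \sum_c p c * f c <= m by exact: le_trans (ler_norm _) fm.
have m2 : \sum_c p c * - f c <= m.
  under eq_bigr do rewrite mulrN.
  by rewrite sumrN (le_trans _ fm)// -normrN ler_norm.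
have s2' : \sum_c p c * (- f c) ^+ 2 <= s2 by under eq_bigr do rewrite sqrrN.
apply: covered_le (coveredU (c1 le1 m0 s20 m1 fs) (c2 le2 m0 s20 m2 s2')) => //.
move=> w [n nN]; rewrite ler_normr => /orP[h|h]; [left|right]; exists n => //.
by rewrite sumrN.
Qed.

End bernstein.
(** * Reduction to uniform variables *)

Section integral_transform.
Context d (T : measurableType d) (R : realType) (P : probability T R).
Context (X : {RV P >-> R}).
Hypothesis hG : continuous (cdf X).
Let G s := fine (cdf X s).

Lemma fine_cdf_itv s : 0 <= G s <= 1.
Proof.
have f : cdf X s \is a fin_num by rewrite fin_num_measure.
by rewrite -!lee_fin /G fineK// cdf_ge0 cdf_le1.
Qed.

Lemma fine_cdf_nd : {homo G : s t / s <= t}.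
Proof.
move=> s t st; rewrite /G fine_le ?fin_num_measure//.
exact: cdf_nondecreasing.
Qed.

Lemma fine_cdfE s : P [set w | X w <= s] = (G s)%:E.
Proof.
by rewrite /G fineK ?fin_num_measure.
Qed.

Lemma measurable_fine_cdf : measurable_fun [set: R] G.
Proof. by apply: nondecreasing_measurable => // s t; exact: fine_cdf_nd. Qed.

Lemma measurable_cdf_le u : measurable [set w | G (X w) <= u].
Proof.
have -> : [set w | G (X w) <= u] = (G \o X) @^-1` `]-oo, u].
  by apply/seteqP; split => w /=; rewrite in_itv.
rewrite -[X in measurable X]setTI.
by apply: (measurableT_comp measurable_fine_cdf) => //; exact: measurable_itv.
Qed.

Lemma fine_cdf_surj u : 0 < u < 1 -> exists s, G s = u.
Proof.
move=> /andP[u0 u1].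
have GNy : G s @[s --> -oo] --> (0:R) by exact/fine_cvg/cvg_cdfNy0.
have Gy : G s @[s --> +oo] --> (1:R) by exact/fine_cvg/cvg_cdfy1.
have [a Ga] : exists a, G a <= u.
  near (ninfty_nbhs R) => a; exists a; apply/ltW.
  by near: a; apply: (cvgr_lt _ GNy).
have [b Gb] : exists b, u <= G b.
  near (pinfty_nbhs R) => b; exists b; apply/ltW.
  by near: b; apply: (cvgr_gt _ Gy).
have cG : continuous G.
  by move=> s; apply: fine_cvg; rewrite /G fineK ?fin_num_measure//; exact: hG.
have [ab|ba] := leP a b.
  have [|c _ Gc] := @IVT R G a b u ab (continuous_subspaceT cG).
    by rewrite ge_min Ga le_max Gb orbT.
  by exists c.
by exists a; apply/eqP; rewrite eq_le Ga (le_trans Gb)// fine_cdf_nd// ltW.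
Unshelve. all: by end_near. Qed.

(** G may be constant on intervals, so the event is compared with events X <= s for s at which G
    takes a prescribed value; such s exist by continuity. *)
Lemma probability_integral_transform (u : R) :
  0 <= u <= 1 -> P [set w | G (X w) <= u] = u%:E.
Proof.
move=> /andP[u0 u1]; have mG := measurable_cdf_le.
have mX s : measurable [set w | X w <= s].
  rewrite -[X in measurable X]setTI.
  have -> : [set w | X w <= s] = X @^-1` `]-oo, s].
    by apply/seteqP; split => w /=; rewrite in_itv.
  exact: (measurable_funPT X).
have fE : P [set w | G (X w) <= u] = (fine (P [set w | G (X w) <= u]))%:E.
  by rewrite fineK// fin_num_measure.
have [u1'|u1'] := eqVneq u 1.
  rewrite u1' (_ : [set w | _] = setT) ?probability_setT//.
  by apply/seteqP; split => w //= _; have /andP[] := fine_cdf_itv (X w).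
have {u1 u1'} u1 : u < 1 by rewrite lt_neqAle u1'.
apply/eqP; rewrite eq_le; apply/andP; split.
  rewrite fE lee_fin leNgt; apply/negP => ux.
  have x1 : fine (P [set w | G (X w) <= u]) <= 1.
    by rewrite -lee_fin -fE probability_le1.
  (* A level strictly between u and the probability supposed larger: G (X) <= u < v = G s forces X
     <= s, so that probability is at most v. *)
  pose v := (u + fine (P [set w | G (X w) <= u])) / 2.
  have v01 : 0 < v < 1 by rewrite /v; apply/andP; split; lra.
  have uv : u < v by rewrite /v; lra.
  have [s Gs] := fine_cdf_surj v01.
  suff : fine (P [set w | G (X w) <= u]) <= v by rewrite /v; lra.
  rewrite -lee_fin -fE -Gs -fine_cdfE le_measure ?inE// => w /= Gw.
  rewrite leNgt; apply/negP => sX.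
  by have := fine_cdf_nd (ltW sX); rewrite Gs; lra.
have [->|u0'] := eqVneq u 0; first by [].
have /fine_cdf_surj[s Gs] : 0 < u < 1 by rewrite lt_neqAle eq_sym u0' u0.
rewrite -[X in (X%:E <= _)%E]Gs -fine_cdfE le_measure ?inE//.
by move=> w /= Xs; rewrite -Gs fine_cdf_nd.
Qed.

End integral_transform.

(** * Indicators as letters of a finite alphabet *)

Section cells.
Context d (T : measurableType d) (R : realType) (P : probability T R).

(* Joint law of the two indicators [U <= u] and [U <= a], for [U] uniform. *)
Definition cell_prob (u a : R) (c : bool * bool) : R :=
  match c with
  | (true, true) => Num.min u a
  | (true, false) => u - Num.min u a
  | (false, true) => a - Num.min u a
  | (false, false) => 1 - Num.max u a
  end.

Definition cell (u a s : R) : bool * bool := (s <= u, s <= a).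

Lemma sum_bool2 (f : bool * bool -> R) :
  \sum_c f c = f (true, true) + f (true, false) + (f (false, true) + f (false, false)).
Proof.
rewrite (eq_bigr (fun c => f (c.1, c.2))) => [|[]//].
by rewrite -(pair_bigA _ (fun x y => f (x, y)))/= !big_bool.
Qed.

Lemma cell_prob_ge0 (u a : R) c : 0 <= u <= 1 -> 0 <= a <= 1 -> 0 <= cell_prob u a c.
Proof.
by move: c => [[] []] /= /andP[? ?] /andP[? ?]; case: (lerP u a) => ?; lra.
Qed.

Lemma sum_cell_prob (u a : R) : \sum_c cell_prob u a c = 1.
Proof. by rewrite sum_bool2/=; case: (lerP u a) => ?; lra. Qed.

Lemma cell_preimage_measurable (U : T -> R) (u a : R) c :
  (forall v : R, measurable [set w | U w <= v]) ->
  measurable [set w | cell u a (U w) = c].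
Proof.
move=> mU; case: c => b1 b2.
have m1 (v : R) b : measurable [set w | (U w <= v) = b].
  case: b; first exact: mU.
  rewrite (_ : [set w | _] = ~` [set w | U w <= v]); first exact: measurableC.
  by apply/seteqP; split => w /=; [move=> ->|move/negP/negbTE].
rewrite (_ : [set w | _] = [set w | (U w <= u) = b1] `&` [set w | (U w <= a) = b2]).
  exact: measurableI.
by apply/seteqP; split => w /=; rewrite /cell => -[-> ->].
Qed.

Lemma cell_probE (U : T -> R) (u a : R) c : 0 <= u <= 1 -> 0 <= a <= 1 ->
  (forall v : R, measurable [set w | U w <= v]) ->
  (forall v : R, 0 <= v <= 1 -> P [set w | U w <= v] = v%:E) ->
  P [set w | cell u a (U w) = c] = (cell_prob u a c)%:E.
Proof.
move=> u01 a01 mU PU.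
have D (x y : R) : 0 <= x <= 1 -> 0 <= y <= 1 ->
    P ([set w | U w <= x] `\` [set w | U w <= y]) = (x - Num.min x y)%:E.
  move=> x01 y01.
  have -> : P ([set w | U w <= x] `\` [set w | U w <= y]) =
      (P [set w | (U w <= x)%R] - P ([set w | (U w <= x)%R] `&` [set w | (U w <= y)%R]))%E.
    by apply: measureD => //; rewrite -ge0_fin_numE// fin_num_measure.
  rewrite PU// (_ : _ `&` _ = [set w | U w <= Num.min x y]).
    by rewrite PU// ?EFinB//; case: (lerP x y).
  by apply/seteqP; split => w /=; rewrite le_min => /andP.
have C (x : R) : 0 <= x <= 1 -> P (~` [set w | U w <= x]) = (1 - x)%:E.
  by move=> x01; rewrite probability_setC// PU.
case: c => [[] []]/=.
- rewrite -PU; last by case: (lerP u a).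
  congr (P _); apply/seteqP; split => w /=; rewrite /cell le_min.
    by case=> -> ->.
  by case/andP => -> ->.
- rewrite -D//; congr (P _); apply/seteqP; split => w /=; rewrite /cell.
    by case=> -> ->.
  by case=> -> /negP/negbTE ->.
- rewrite minC -D//; congr (P _); apply/seteqP; split => w /=; rewrite /cell.
    by case=> -> ->.
  by case=> -> /negP/negbTE ->.
- rewrite -C; last by case: (lerP u a).
  congr (P _); apply/seteqP; split => w /=; rewrite /cell le_max.
    by case=> -> ->.
  by move/negP; rewrite negb_or => /andP[/negbTE-> /negbTE->].
Qed.

End cells.
Section null_covers.
Context d (T : measurableType d) (R : realType) (P : probability T R).

Lemma covered_null (B : set T) :
  (forall m, covered P B m.+1%:R^-1) -> {ae P, forall w, ~ B w}.
Proof.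
move=> cB; have {cB}[E hE] := choice cB; exists (\bigcap_m E m).
have mE m : measurable (E m) by have [] := hE m.
split; first exact: bigcap_measurable.
  apply/eqP; rewrite eq_le measure_ge0 andbT.
  apply/lee_addgt0Pr => e e0; rewrite add0e.
  have [m _ /(_ m (leqnn m))/= me] := near_infty_natSinv_lt (PosNum e0).
  have [_ _ PE] := hE m.
  apply: (@le_trans _ _ (P (E m))).
    by rewrite le_measure ?inE//; [exact: bigcap_measurable|exact: bigcap_inf].
  by rewrite (le_trans PE)// lee_fin ltW.
by move=> w /= /contrapT Bw m _; have [_ + _] := hE m; apply.
Qed.

End null_covers.

Section coordinate_measurability.
Context (R : realType) (G : R -> R).
Hypothesis mG : measurable_fun [set: R] G.

Lemma measurable_fst_le (v : R) : measurable [set z : R * R | G z.1 <= v].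
Proof.
have -> : [set z : R * R | G z.1 <= v] = setT `&` (G \o fst) @^-1` `]-oo, v].
  by rewrite setTI; apply/seteqP; split => w /=; rewrite in_itv.
by apply: (measurableT_comp mG) => //; exact: measurable_itv.
Qed.

Lemma measurable_snd_le (v : R) : measurable [set z : R * R | G z.2 <= v].
Proof.
have -> : [set z : R * R | G z.2 <= v] = setT `&` (G \o snd) @^-1` `]-oo, v].
  by rewrite setTI; apply/seteqP; split => w /=; rewrite in_itv.
by apply: (measurableT_comp mG) => //; exact: measurable_itv.
Qed.

End coordinate_measurability.

Section sample_words.
Context d (T : measurableType d) (R : realType) (P : probability T R).
Context (X Y : {RV P >-> R}) (Xs Ys : nat -> {RV P >-> R}).
Hypothesis hXY : independent_RVs P X Y.
Hypothesis hlaw : forall i, same_law P (fun w => (Xs i w, Ys i w))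
                                       (fun w => (X w, Y w)).
Hypothesis hind : mutually_independent P (fun i w => (Xs i w, Ys i w)).

Lemma measurable_pair_preimage (A B : {RV P >-> R}) (S : set (R * R)) :
  measurable S -> measurable [set w | S (A w, B w)].
Proof.
move=> mS.
have mAB : measurable_fun [set: T] (fun w => (A w, B w)).
  by apply: measurable_fun_pair; exact: measurable_funPT.
by rewrite -[X in measurable X]setTI; exact: mAB.
Qed.

Lemma iid_words_sample (F : finType) (phi : R * R -> F) :
  (forall c, measurable [set z | phi z = c]) ->
  iid_words P (fun i w => phi (Xs i w, Ys i w))
    (fun c => fine (P [set w | phi (X w, Y w) = c])).
Proof.
move=> mphi s.
(* The empty word is set apart: a nonempty one supplies the default letter that [nth] requires. *)
case: s => [|c0 s'].
  rewrite big_nil (_ : word_event _ _ = setT) ?probability_setT//.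
  by apply/seteqP; split.
move: (c0 :: s') => s.
pose A i := [set z | phi z = nth c0 s i].
pose J : {fset nat} := [fset i in iota 0 (size s)]%fset.
have EJ : word_event (fun i w => phi (Xs i w, Ys i w)) s =
    \bigcap_(i in [set` J]) ((fun w => (Xs i w, Ys i w)) @^-1` A i).
  apply/seteqP; split => w /=; rewrite /word_event/=.
    move=> E i /=; rewrite !inE mem_iota /= => ik; rewrite /A /=.
    by rewrite -[in RHS]E nth_mkseq.
  move=> h; apply: (@eq_from_nth _ c0); rewrite size_mkseq// => i ik.
  by rewrite nth_mkseq//; apply: h; rewrite /= !inE mem_iota.
have mA i : measurable (A i) by exact: mphi.
split.
  rewrite EJ; apply: fin_bigcap_measurable => [|i _]; first exact: finite_fset.
  exact: measurable_pair_preimage.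
rewrite EJ hind//.
rewrite (perm_big (iota 0 (size s)))/=; last first.
  apply: uniq_perm; rewrite ?fset_uniq ?iota_uniq// => i.
  by rewrite !inE.
rewrite -prodEFin [in RHS](big_nth c0) /index_iota subn0.
apply: eq_bigr => i _.
by rewrite hlaw// fineK// fin_num_measure//; exact: (measurable_pair_preimage X Y (mA i)).
Qed.

Lemma iid_words_eq (F : finType) (W : nat -> T -> F) (p q : F -> R) :
  p =1 q -> iid_words P W p -> iid_words P W q.
Proof. by move=> /funext <-. Qed.

Section coordinate.
Context (psi : R * R -> R).
Hypothesis mpsi : forall v : R, measurable [set z | psi z <= v].
Hypothesis Ppsi : forall v : R, 0 <= v <= 1 ->
  P [set w | psi (X w, Y w) <= v] = v%:E.

Let mpsiXY (v : R) : measurable [set w | psi (X w, Y w) <= v].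
Proof. exact: (measurable_pair_preimage X Y (mpsi v)). Qed.

Lemma iid_words_cell (u a : R) : 0 <= u <= 1 -> 0 <= a <= 1 ->
  iid_words P (fun i w => cell u a (psi (Xs i w, Ys i w))) (cell_prob u a).
Proof.
move=> u01 a01.
have := iid_words_sample (fun c => cell_preimage_measurable u a c mpsi).
by apply: iid_words_eq => c; rewrite (cell_probE c u01 a01 mpsiXY Ppsi).
Qed.

(** Needed for the quantile of order 0, which is -oo: on the uniform scale it becomes the level 0,
    below every observation. *)
Lemma ae_coordinate_gt0 : {ae P, forall w, forall i, 0 < psi (Xs i w, Ys i w)}.
Proof.
apply: ae_foralln => i.
exists [set w | psi (Xs i w, Ys i w) <= 0]; split.
- exact: (measurable_pair_preimage (Xs i) (Ys i) (mpsi 0)).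
- by have /= -> := hlaw i (mpsi 0); rewrite Ppsi// lexx ler01.
- by move=> w /= /negP; rewrite -leNgt.
Qed.

(* Two independent uniform variables share a cell of the regular partition of
   (0, 1] into m + 1 cells with probability 1 / (m + 1). *)
Lemma ae_coordinate_neq : {ae P, forall w, forall i j, i != j ->
  psi (Xs i w, Ys i w) != psi (Xs j w, Ys j w)}.
Proof.
apply: ae_foralln => i; apply: ae_foralln => j.
have [->|ij] := eqVneq i j; first exact: aeW.
pose U l w := psi (Xs l w, Ys l w).
have U0 := ae_coordinate_gt0.
have H : {ae P, forall w, ~ (0 < U i w <= 1 /\ U i w = U j w)}.
  apply: covered_null => m.
  pose A (c : 'I_m.+1) :=
    [set z | cell (c%:R / m.+1%:R) (c.+1%:R / m.+1%:R) (psi z) = (false, true)].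
  have mA c : measurable (A c) by exact: cell_preimage_measurable.
  have PA l c : P [set w | A c (Xs l w, Ys l w)] = (m.+1%:R^-1)%:E.
    rewrite (hlaw l (mA c)) /A.
    rewrite (@cell_probE _ _ _ _ (fun w => psi (X w, Y w)))//=.
    - congr EFin; rewrite min_l ?ler_wpM2r ?ler_nat//.
      by rewrite -mulrBl -natrB// subSnn mul1r.
    - rewrite divr_ge0//= ler_pdivrMr// mul1r ler_nat; exact/ltnW/ltn_ord.
    - rewrite divr_ge0//= ler_pdivrMr// mul1r ler_nat; exact/ltn_ord.
  have C c : covered P [set w | A c (Xs i w, Ys i w) /\ A c (Xs j w, Ys j w)]
      (m.+1%:R^-1 * m.+1%:R^-1).
    exists [set w | A c (Xs i w, Ys i w) /\ A c (Xs j w, Ys j w)]; split => //.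
      by apply: measurableI; exact: measurable_pair_preimage.
    have := hind [fset i; j]%fset (fun=> mA c).
    rewrite big_fsetU1 ?inE//= big_seq_fset1 !PA => E.
    rewrite [X in (_ <= X)%E]EFinM -E.
    rewrite le_eqVlt; apply/orP; left; apply/eqP; congr (P _).
    apply/seteqP; split => w /=.
      by move=> [Ai Aj] l /=; rewrite !inE => /orP[]/eqP->.
    by move=> h; split; apply: h; rewrite /= !inE eqxx ?orbT.
  apply: covered_le (covered_card C); last first.
    by rewrite card_ord mulrA divff// mul1r.
  move=> w /= [/andP[U0w U1w] Uij].
  (* The least n with (m + 1) U <= n is c + 1, where c is the index of the left-open cell of U; U >
     0 excludes n = 0. *)
  have ex : exists n, m.+1%:R * U i w <= n%:R.
    by exists m.+1; rewrite ler_piMr.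
  case: (ex_minnP ex) => -[|c] hc cmin.
    by move: hc; rewrite leNgt mulr_gt0.
  have cm : (c < m.+1)%N by apply: cmin; rewrite ler_piMr.
  have cU : c%:R < m.+1%:R * U i w.
    by rewrite ltNge; apply/negP => /cmin; rewrite ltnn.
  have Aw : A (Ordinal cm) (Xs i w, Ys i w).
    rewrite /A /= /cell; congr pair.
      by apply/negbTE; rewrite -ltNge ltr_pdivrMr// mulrC.
    by rewrite ler_pdivlMr// mulrC.
  by exists (Ordinal cm) => //; split=> //; rewrite /A /= -[psi (Xs j w, Ys j w)]Uij.
have U1 : {ae P, forall w, U i w <= 1}.
  exists [set w | ~ psi (Xs i w, Ys i w) <= 1]; split => //.
    by apply: measurableC; exact: (measurable_pair_preimage (Xs i) (Ys i) (mpsi 1)).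
  have m1 : measurable [set z | ~ psi z <= 1] by apply: measurableC; exact: mpsi.
  have /= -> := hlaw i m1.
  rewrite [LHS](_ : _ = P (~` [set w | psi (X w, Y w) <= 1]))//.
  by rewrite probability_setC// Ppsi ?subee// lexx ler01.
apply: filterS3 U0 U1 H => w U0 U1 H _; apply/eqP => Uij; apply: H.
by rewrite U0 U1.
Qed.

End coordinate.

Context (G H : R -> R).
Hypothesis mG : measurable_fun [set: R] G.
Hypothesis mH : measurable_fun [set: R] H.
Hypothesis PG : forall u, 0 <= u <= 1 -> P [set w | G (X w) <= u] = u%:E.
Hypothesis PH : forall u, 0 <= u <= 1 -> P [set w | H (Y w) <= u] = u%:E.

Let mGX (v : R) : measurable [set w | G (X w) <= v].
Proof. exact: (measurable_pair_preimage X Y (measurable_fst_le mG v)). Qed.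

Let mHY (v : R) : measurable [set w | H (Y w) <= v].
Proof. exact: (measurable_pair_preimage X Y (measurable_snd_le mH v)). Qed.

Lemma iid_words_cell2 (u a v b : R) : 0 <= u <= 1 -> 0 <= a <= 1 ->
  0 <= v <= 1 -> 0 <= b <= 1 ->
  iid_words P (fun i w => (cell u a (G (Xs i w)), cell v b (H (Ys i w))))
    (fun c => cell_prob u a c.1 * cell_prob v b c.2).
Proof.
move=> u01 a01 v01 b01.
have := @iid_words_sample _ (fun z => (cell u a (G z.1), cell v b (H z.2))).
have E c : [set z : R * R | (cell u a (G z.1), cell v b (H z.2)) = c] =
  [set z | cell u a (G z.1) = c.1] `&` [set z | cell v b (H z.2) = c.2].
  apply/seteqP; split => z /=; first by move=> <-.
  by case: c => c1 c2 /= [-> ->].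
have mc c : measurable [set z : R * R | (cell u a (G z.1), cell v b (H z.2)) = c].
  rewrite E; apply: measurableI.
    by apply: cell_preimage_measurable => v'; exact: measurable_fst_le.
  by apply: cell_preimage_measurable => v'; exact: measurable_snd_le.
move=> /(_ mc); apply: iid_words_eq => c.
have mX : measurable [set x | cell u a (G x) = c.1].
  apply: (@cell_preimage_measurable _ _ _ G) => v'.
  rewrite -[X in measurable X]setTI (_ : [set w | _] = G @^-1` `]-oo, v']).
    exact: mG.
  by apply/seteqP; split => w /=; rewrite in_itv.
have mY : measurable [set x | cell v b (H x) = c.2].
  apply: (@cell_preimage_measurable _ _ _ H) => v'.
  rewrite -[X in measurable X]setTI (_ : [set w | _] = H @^-1` `]-oo, v']).
    exact: mH.
  by apply/seteqP; split => w /=; rewrite in_itv.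
have := hXY mX mY.
rewrite (_ : _ `&` _ = [set w | (cell u a (G (X w)), cell v b (H (Y w))) = c]).
  move=> ->; rewrite (cell_probE c.1 u01 a01 mGX PG).
  by rewrite (cell_probE c.2 v01 b01 mHY PH).
apply/seteqP; split => z /=; last by move=> <-.
by case: c {E mc mX mY} => c1 c2 /= [-> ->].
Qed.

End sample_words.
(** * Moments of the summands *)

Section cell_moments.
Context (R : realType).
Implicit Types u a v b : R.

Lemma sum_cell_prod (p q f g : bool * bool -> R) :
  \sum_c p c.1 * q c.2 * (f c.1 * g c.2) =
  (\sum_c p c * f c) * (\sum_c q c * g c).
Proof.
rewrite big_distrlr/= (pair_bigA _ (fun x y => p x * f x * (q y * g y)))/=.
by apply: eq_bigr => c _; ring.
Qed.

Lemma cell_prob_fst u a (f : bool -> R) :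
  \sum_c cell_prob u a c * f c.1 = u * f true + (1 - u) * f false.
Proof. by rewrite sum_bool2/=; case: (lerP u a) => _; ring. Qed.

Lemma cell_prob_diff u a :
  \sum_c cell_prob u a c * (c.2%:R - c.1%:R) = a - u.
Proof. by rewrite sum_bool2/=; case: (lerP u a) => _; ring. Qed.

Lemma cell_prob_absdiff u a :
  \sum_c cell_prob u a c * `|c.2%:R - c.1%:R| = `|a - u|.
Proof.
rewrite sum_bool2/= !(subr0, sub0r, subrr, normr0, normr1, normrN1).
by have [ua|au] := lerP u a; ring.
Qed.

(* The cell [c] records the indicators ((U <= u, U <= a), (V <= v, V <= b)). *)
Definition zeta u v (c : (bool * bool) * (bool * bool)) : R :=
  (c.1.2%:R * c.2.2%:R - c.1.1%:R * c.2.1%:R)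
  - u * (c.2.2%:R - c.2.1%:R) - v * (c.1.2%:R - c.1.1%:R).

Lemma zeta_le3 u v c : 0 <= u <= 1 -> 0 <= v <= 1 -> `|zeta u v c| <= 3%:R.
Proof.
move=> /andP[u0 u1] /andP[v0 v1]; rewrite /zeta.
by case: c => [[[] []] [[] []]] /=; rewrite ler_norml; apply/andP; split; lra.
Qed.

(** Write p0, p, q0, q for the four indicators. Then zeta = (p0 - u) (q - q0) + (p - p0) (q0 - v) +
    (p - p0) (q - q0). If only one coordinate changes, the square is one of the first two terms on
    the right; if both do, 7 is a generous allowance, harmless because it ends up multiplying the
    square of the window. *)
Lemma zeta_sqr_le u v c : 0 <= u <= 1 -> 0 <= v <= 1 ->
  zeta u v c ^+ 2 <= (c.1.1%:R - u) ^+ 2 * `|c.2.2%:R - c.2.1%:R|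
    + `|c.1.2%:R - c.1.1%:R| * (c.2.1%:R - v) ^+ 2
    + 7%:R * (`|c.1.2%:R - c.1.1%:R| * `|c.2.2%:R - c.2.1%:R|).
Proof.
move=> /andP[u0 u1] /andP[v0 v1]; rewrite /zeta.
case: c => [[[] []] [[] []]] /=;
  rewrite !(subr0, sub0r, subrr, normr0, normr1, normrN1); nra.
Qed.

(** In the same decomposition, independence factors each mean, and p0 - u and q0 - v are centered:
    only the last product survives. This first-order cancellation is what the linear corrections in
    [zeta] achieve. *)
Lemma zeta_mean u a v b :
  \sum_c cell_prob u a c.1 * cell_prob v b c.2 * zeta u v c = (a - u) * (b - v).
Proof.
rewrite (eq_bigr (fun c =>
   cell_prob u a c.1 * cell_prob v b c.2 * ((c.1.1%:R - u) * (c.2.2%:R - c.2.1%:R))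
 + cell_prob u a c.1 * cell_prob v b c.2 * ((c.1.2%:R - c.1.1%:R) * (c.2.1%:R - v))
 + cell_prob u a c.1 * cell_prob v b c.2 *
     ((c.1.2%:R - c.1.1%:R) * (c.2.2%:R - c.2.1%:R)))); last first.
  by move=> c _; rewrite /zeta; ring.
rewrite !big_split/=.
rewrite (sum_cell_prod _ _ (fun c => c.1%:R - u) (fun c => c.2%:R - c.1%:R)).
rewrite (sum_cell_prod _ _ (fun c => c.2%:R - c.1%:R) (fun c => c.1%:R - v)).
rewrite (sum_cell_prod _ _ (fun c => c.2%:R - c.1%:R) (fun c => c.2%:R - c.1%:R)).
rewrite !cell_prob_diff (cell_prob_fst _ _ (fun x => x%:R - u)).
by rewrite (cell_prob_fst _ _ (fun x => x%:R - v))/=; ring.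
Qed.

(** Keeping the variance bound sigma, instead of 1/4 throughout, is what makes the final constant
    small when gamma is small. *)
Lemma zeta_second_moment u a v b sigma rho :
  0 <= u <= 1 -> 0 <= a <= 1 -> 0 <= v <= 1 -> 0 <= b <= 1 ->
  u * (1 - u) <= sigma -> v * (1 - v) <= sigma ->
  `|a - u| <= rho -> `|b - v| <= rho ->
  \sum_c cell_prob u a c.1 * cell_prob v b c.2 * zeta u v c ^+ 2 <=
    2%:R * sigma * rho + 7%:R * rho ^+ 2.
Proof.
move=> u01 a01 v01 b01 us vs ar br.
apply: (@le_trans _ _ (\sum_c
   (cell_prob u a c.1 * cell_prob v b c.2 * ((c.1.1%:R - u) ^+ 2 * `|c.2.2%:R - c.2.1%:R|)
 + cell_prob u a c.1 * cell_prob v b c.2 * (`|c.1.2%:R - c.1.1%:R| * (c.2.1%:R - v) ^+ 2)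
 + 7%:R * (cell_prob u a c.1 * cell_prob v b c.2 *
     (`|c.1.2%:R - c.1.1%:R| * `|c.2.2%:R - c.2.1%:R|))))).
  apply: ler_sum => c _.
  have p0 : 0 <= cell_prob u a c.1 * cell_prob v b c.2.
    by rewrite mulr_ge0// cell_prob_ge0.
  apply: le_trans (ler_wpM2l p0 (zeta_sqr_le c u01 v01)) _.
  by rewrite le_eqVlt; apply/orP; left; apply/eqP; ring.
rewrite !big_split/= -mulr_sumr.
rewrite (sum_cell_prod _ _ (fun c => (c.1%:R - u) ^+ 2) (fun c => `|c.2%:R - c.1%:R|)).
rewrite (sum_cell_prod _ _ (fun c => `|c.2%:R - c.1%:R|) (fun c => (c.1%:R - v) ^+ 2)).
rewrite (sum_cell_prod _ _ (fun c => `|c.2%:R - c.1%:R|) (fun c => `|c.2%:R - c.1%:R|)).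
rewrite !cell_prob_absdiff (cell_prob_fst _ _ (fun x => (x%:R - u) ^+ 2)).
rewrite (cell_prob_fst _ _ (fun x => (x%:R - v) ^+ 2)).
have := normr_ge0 (a - u); have := normr_ge0 (b - v).
move: (`|a - u|) (`|b - v|) ar br => x y xr yr y0 x0.
have -> : u * (true%:R - u) ^+ 2 + (1 - u) * (false%:R - u) ^+ 2 = u * (1 - u).
  by rewrite /=; ring.
have -> : v * (true%:R - v) ^+ 2 + (1 - v) * (false%:R - v) ^+ 2 = v * (1 - v).
  by rewrite /=; ring.
have us0 : 0 <= u * (1 - u) by case/andP: u01 => *; nra.
have vs0 : 0 <= v * (1 - v) by case/andP: v01 => *; nra.
have E1 : u * (1 - u) * y <= sigma * rho by exact: ler_pM.
have E2 : x * (v * (1 - v)) <= rho * sigma by exact: ler_pM.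
have E3 : x * y <= rho * rho by exact: ler_pM.
lra.
Qed.

End cell_moments.

Section uniform_deviation.
Context d (T : measurableType d) (R : realType) (P : probability T R).
Context (U : nat -> T -> R).
Hypothesis hU : forall u a : R, 0 <= u <= 1 -> 0 <= a <= 1 ->
  iid_words P (fun i w => cell u a (U i w)) (cell_prob u a).

Definition centered_count (n : nat) (s : R) (w : T) : R :=
  \sum_(i < n) ((U i w <= s)%R%:R - s).

Lemma centered_count_deviation (s x : R) (N : nat) : 0 <= s <= 1 ->
  0 < x -> (0 < N)%N -> 169%:R * x <= 13%:R / 25%:R * (N%:R * 4^-1) ->
  covered P [set w | exists2 n, (n <= N)%N &
     2%:R * Num.sqrt (13%:R / 25%:R * (N%:R * 4^-1) * x)
       <= `|centered_count n s w|] (2%:R * expR (- x)).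
Proof.
move=> s01 x0 N0 hx.
have H := @bernstein_maximal_abs _ _ _ _ _ _ _ (hU s01 s01)
  (fun c => cell_prob_ge0 c s01 s01) (sum_cell_prob s s) (fun c => c.1%:R - s)
  1 0 4^-1 x N.
apply: covered_le (lexx _) (H _ _ _ x0 _ _).
- by move=> w [n nN h]; exists n => //; rewrite mulr0 add0r.
- by move=> [[] ?]/=; case/andP: s01 => *; rewrite ler_norml; apply/andP; split; lra.
- rewrite (cell_prob_fst _ _ (fun x => x%:R - s))/=.
  by rewrite [X in `|X|](_ : _ = 0) ?normr0//; ring.
- rewrite (cell_prob_fst _ _ (fun x => (x%:R - s) ^+ 2))/=.
  have := sqr_ge0 (s - 2^-1); nra.
- by rewrite mulr_gt0 ?ltr0n// invr_gt0.
- by rewrite expr1n mulr1.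
Qed.

Lemma centered_count_increment (u a s2 x : R) (N : nat) :
  0 <= u -> u <= a -> a <= 1 -> a - u <= s2 ->
  0 < x -> 0 < N%:R * s2 -> 169%:R * x <= 13%:R / 25%:R * (N%:R * s2) ->
  covered P [set w | exists2 n, (n <= N)%N &
     2%:R * Num.sqrt (13%:R / 25%:R * (N%:R * s2) * x)
       <= `|centered_count n a w - centered_count n u w|] (2%:R * expR (- x)).
Proof.
move=> u0 ua a1 aus x0 N0 hx.
have u01 : 0 <= u <= 1 by rewrite u0 (le_trans ua).
have a01 : 0 <= a <= 1 by rewrite a1 (le_trans u0).
have H := @bernstein_maximal_abs _ _ _ _ _ _ _ (hU u01 a01)
  (fun c => cell_prob_ge0 c u01 a01) (sum_cell_prob u a)
  (* The cell (true, false) is impossible when u <= a; the value 0 there keeps the summand within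
     [-1, 1]. *)
  (fun c => if c == (true, false) then 0 else (c.2%:R - c.1%:R) - (a - u))
  1 0 s2 x N.
apply: covered_le (lexx _) (H _ _ _ x0 N0 _).
- move=> w [n nN h]; exists n => //; rewrite mulr0 add0r (le_trans h)//.
  rewrite le_eqVlt; apply/orP; left; apply/eqP; congr (`|_|).
  rewrite -sumrB; apply: eq_bigr => i _.
  rewrite /cell; case: ifP => [|_]/=; last by ring.
  by case/eqP => Uu; rewrite (le_trans Uu ua).
- move=> [[] []] /=; rewrite ?normr0//= ler_norml; apply/andP; split; lra.
- rewrite sum_bool2/= min_l// max_r//.
  by rewrite [X in `|X|](_ : _ = 0) ?normr0//; ring.
- rewrite sum_bool2/= min_l// max_r//; nra.
- by rewrite expr1n mulr1.
Qed.

End uniform_deviation.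
(** * An explicit law of the iterated logarithm *)

Section growth.
Context (R : realType).

(** Telescoping: n^(-3/2) <= 4 (n^(-1/2) - (n + 1)^(-1/2)). Each use of Borel-Cantelli compares its
    probabilities with n^(-3/2). *)
Lemma sum_inv_n_sqrt_le4 (n0 N : nat) : (0 < n0)%N ->
  \sum_(n0 <= n < N) (n%:R * Num.sqrt n%:R : R)^-1 <= 4.
Proof.
move=> n00.
have [Nn|nN] := leqP N n0; first by rewrite big_geq.
pose a n : R := (Num.sqrt n%:R)^-1.
apply: (@le_trans _ _ (\sum_(n0 <= n < N) 4 * (a n - a n.+1))).
  rewrite big_nat [leRHS]big_nat; apply: ler_sum => n /andP[n0n _].
  have n0' : (0 < n)%N by exact: leq_trans n0n.
  have n1 : 1 <= n%:R :> R by rewrite ler1n.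
  rewrite /a; set x := Num.sqrt n%:R; set y := Num.sqrt n.+1%:R.
  have x0 : 0 < x by rewrite sqrtr_gt0 ltr0n.
  have y0 : 0 < y by rewrite sqrtr_gt0 ltr0n.
  have xx : x ^+ 2 = n%:R by rewrite sqr_sqrtr.
  have yy : y ^+ 2 = n%:R + 1 by rewrite sqr_sqrtr// natr1.
  have xy : x <= y by rewrite ler_wsqrtr// ler_nat.
  have -> : 4 * (x^-1 - y^-1) = 4 * (y - x) / (x * y) by field; rewrite !gt_eqF.
  have -> : y - x = (x + y)^-1.
    have h : (y - x) * (x + y) = 1.
      by rewrite (_ : _ * _ = y ^+ 2 - x ^+ 2); [rewrite xx yy|]; ring.
    by rewrite -[LHS]mulr1 -[X in _ * X](@divff _ (x + y)) ?gt_eqF ?addr_gt0// mulrA h mul1r.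
  rewrite -xx -mulrA -invfM ler_pdivlMr ?mulr_gt0 ?addr_gt0//.
  rewrite mulrC ler_pdivrMr ?mulr_gt0 ?exprn_gt0//.
  have E1 : y ^+ 2 <= 2 * x ^+ 2 by rewrite xx yy; lra.
  have E2 : x * y <= y ^+ 2 by rewrite expr2 ler_pM2r.
  have -> : (x + y) * (x * y) = x * (x * y + y ^+ 2) by ring.
  have -> : 4 * (x ^+ 2 * x) = x * (4 * x ^+ 2) by ring.
  by rewrite ler_pM2l//; lra.
rewrite -mulr_sumr.
rewrite (telescope_sumr_eq (fun n => - a n)) ?(ltnW nN)// => [|n _]; last first.
  by rewrite opprK addrC.
have a0 n : 0 <= a n by rewrite invr_ge0 sqrtr_ge0.
have a1 : a n0 <= 1.
  by rewrite invf_le1 ?sqrtr_gt0 ?ltr0n// -[leLHS]sqrtr1 ler_wsqrtr// ler1n.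
by have := a0 N; lra.
Qed.

Lemma exprn_le_expR (K : R) (m : nat) :
  exists x0 : R, 0 <= x0 /\ forall x, x0 <= x -> K * x ^+ m <= expR x.
Proof.
exists (`|K| * m.+1`!%:R); split; first by rewrite mulr_ge0.
move=> x hx; have x0 : 0 <= x by apply: le_trans hx; rewrite mulr_ge0.
have := expR_ge1Dxn m x0; apply: le_trans.
rewrite -[leLHS]add0r lerD//.
have f0 : (0:R) < m.+1`!%:R by rewrite ltr0n fact_gt0.
rewrite ler_pdivlMr// mulrAC exprS.
rewrite ler_wpM2r ?exprn_ge0//; apply: le_trans hx.
by rewrite ler_wpM2r ?ler0n// ler_norm.
Qed.

Lemma expR_half_le_exp2 (j : nat) : expR (j%:R / 2) <= 2 ^+ j :> R.
Proof.
rewrite expRM_natl; apply: lerXn2r; rewrite ?nnegrE ?expR_ge0//.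
have := expR_ge1Dx (- 2^-1 : R).
rewrite expRN -ler_pV2 ?inE ?unitfE ?gt_eqF ?invr_gt0 ?expR_gt0 ?invrK//; lra.
Qed.

Lemma exp2_le_expR (j : nat) : 2 ^+ j <= expR j%:R :> R.
Proof.
rewrite -[j%:R]mulr1 expRM_natl; apply: lerXn2r; rewrite ?nnegrE ?expR_ge0//.
by have := expR_ge1Dx (1 : R); lra.
Qed.

End growth.
Section iterated_logarithm.
Context d (T : measurableType d) (R : realType) (P : probability T R).
Context (U : nat -> T -> R).
Hypothesis hU : forall u a : R, 0 <= u <= 1 -> 0 <= a <= 1 ->
  iid_words P (fun i w => cell u a (U i w)) (cell_prob u a).

Lemma centered_count_le (n : nat) (s t : R) w : s <= t ->
  centered_count U n s w <= centered_count U n t w + n%:R * (t - s).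
Proof.
move=> st; rewrite /centered_count.
rewrite -[n in n%:R * _](card_ord n) mulr_natl -sumr_const -big_split/=.
apply: ler_sum => i _; rewrite addrA subrK lerD2r ler_nat.
by case: (leP (U i w) s) => // Us; rewrite (le_trans Us st).
Qed.

Lemma truncn_grid (M : nat) (s : R) : (0 < M)%N -> 0 <= s -> s < 1 ->
  exists2 c : nat, (c < M)%N & c%:R / M%:R <= s < c.+1%:R / M%:R.
Proof.
move=> M0 s0 s1; exists (Num.truncn (s * M%:R)).
  by rewrite truncn_lt_nat ?mulr_ge0// gtr_pMl ?ltr0n.
have /archimedean.Num.Theory.truncn_itv/andP[h1 h2] : 0 <= s * M%:R by rewrite mulr_ge0.
by rewrite ler_pdivrMr ?ltr0n// h1 ltr_pdivlMr ?ltr0n.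
Qed.

(** Two-scale chaining: s is located between multiples of 1/j, then between multiples of 1/(j M).
    Since n <= M, monotonicity of the counts makes the last rounding cost at most 1. *)
Lemma centered_count_grid (n j M : nat) (t1 t2 : R) w :
  (n <= M)%N -> (0 < j)%N -> (0 < M)%N -> 0 <= t2 ->
  (forall c, (c <= j)%N -> `|centered_count U n (c%:R / j%:R) w| <= t1) ->
  (forall c e, (c < j)%N -> (e <= M)%N ->
    `|centered_count U n ((c%:R + e%:R / M%:R) / j%:R) w
      - centered_count U n (c%:R / j%:R) w| <= t2) ->
  forall s, 0 <= s <= 1 -> `|centered_count U n s w| <= t1 + t2 + 1.
Proof.
move=> nM j0 M0 t20 h1 h2 s /andP[s0 s1].
have [->|s1'] := eqVneq s 1.
  have := h1 j (leqnn j); rewrite divff ?pnatr_eq0 -?lt0n// => h.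
  by rewrite (le_trans h)// -addrA lerDl addr_ge0.
have {s1 s1'} s1 : s < 1 by rewrite lt_neqAle s1'.
have [c cj /andP[cs sc]] := truncn_grid j0 s0 s1.
have jR : 0 < j%:R :> R by rewrite ltr0n.
have MR : 0 < M%:R :> R by rewrite ltr0n.
have [| |e eM /andP[es se]] := @truncn_grid M (s * j%:R - c%:R) M0.
- by rewrite subr_ge0 -ler_pdivrMr.
- by rewrite ltrBlDr -ltr_pdivlMr// nat1r.
have B e' : (e' <= M)%N ->
    `|centered_count U n ((c%:R + e'%:R / M%:R) / j%:R) w| <= t1 + t2.
  move=> e'M; rewrite -[centered_count _ _ _ _](subrK (centered_count U n (c%:R / j%:R) w)).
  by rewrite addrC (le_trans (ler_normD _ _))// lerD ?h1 ?h2// ltnW.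
have lo : (c%:R + e%:R / M%:R) / j%:R <= s by rewrite ler_pdivrMr// -lerBrDl.
have hi : s <= (c%:R + e.+1%:R / M%:R) / j%:R.
  by rewrite ler_pdivlMr// -lerBlDl ltW.
have gap : (c%:R + e.+1%:R / M%:R) / j%:R - (c%:R + e%:R / M%:R) / j%:R
    = (M%:R * j%:R)^-1 :> R.
  by rewrite -natr1; field; rewrite !gt_eqF.
have gapn : n%:R * (M%:R * j%:R)^-1 <= 1 :> R.
  rewrite ler_pdivrMr ?mulr_gt0// mul1r (le_trans (_ : _ <= M%:R)) ?ler_nat//.
  by rewrite ler_peMr ?ler1n.
have C1 := centered_count_le n w hi.
have C2 := centered_count_le n w lo.
have := B _ eM; have := B _ (ltnW eM).
rewrite !ler_norml => /andP[B1 B2] /andP[B3 B4].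
have G1 : n%:R * ((c%:R + e.+1%:R / M%:R) / j%:R - s) <= 1.
  apply: le_trans gapn; rewrite -gap ler_wpM2l//; lra.
have G2 : n%:R * (s - (c%:R + e%:R / M%:R) / j%:R) <= 1.
  apply: le_trans gapn; rewrite -gap ler_wpM2l//; lra.
by apply/andP; split; lra.
Qed.

End iterated_logarithm.
Section lil_blocks.
Context d (T : measurableType d) (R : realType) (P : probability T R).
Context (U : nat -> T -> R).
Hypothesis hU : forall u a : R, 0 <= u <= 1 -> 0 <= a <= 1 ->
  iid_words P (fun i w => cell u a (U i w)) (cell_prob u a).

(* Over the block of the n with [n %/ 2 ^ j] fixed, [coarse_bound] controls the
   j + 1 points c/j, each with probability j^(-5/2), and [fine_bound] the
   increments over intervals of length at most 1/j, with probability e^(-4j). *)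
Definition coarse_bound (N j : nat) : R :=
  2%:R * Num.sqrt (13%:R / 25%:R * (N%:R * 4^-1) * (5%:R / 2%:R * ln j%:R)).

Definition fine_bound (N j : nat) : R :=
  2%:R * Num.sqrt (13%:R / 25%:R * (N%:R * j%:R^-1) * (4%:R * j%:R)).

Definition block_end (n j : nat) : nat := ((n %/ 2 ^ j).+1 * 2 ^ j)%N.

(** Union bound: 16 blocks, j + 1 coarse points and probability j^(-5/2) give order j^(-3/2), while
    e^(-4j) outweighs the j (16 2^j + 1) fine points. Blocks of length 2^j, rather than doubling
    blocks, keep the end of a block close to n. *)
Lemma lil_block : exists j0 : nat, forall j, (j0 <= j)%N ->
  covered P [set w | exists n s, [/\ (n < 16 * 2 ^ j)%N, 0 <= s <= 1 &
      coarse_bound (block_end n j) j + fine_bound (block_end n j) j + 1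
        < `|centered_count U n s w|]]
    (640%:R * (j%:R * Num.sqrt j%:R)^-1).
Proof.
(* Taken at j/2, this gives 4000 j^2 <= 2^j, enough for Bernstein's condition at both scales. *)
have [y0 [y00 Hy]] := exprn_le_expR (16 * 1000 : R) 2.
exists (Num.truncn (2 * y0) + 2)%N => j hj.
have j2 : (2 <= j)%N by rewrite (leq_trans _ hj)// leq_addl.
have j0 : (0 < j)%N by exact: leq_trans j2.
have jR : 2 <= j%:R :> R by rewrite (ler_nat _ 2).
have jR0 : 0 < j%:R :> R by lra.
have big : 4000%:R * j%:R ^+ 2 <= 2 ^+ j :> R.
  apply: le_trans (expR_half_le_exp2 R j).
  have : y0 <= j%:R / 2.
    rewrite ler_pdivlMr// mulrC ltW// (lt_le_trans (truncnS_gt _))//.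
    by rewrite ler_nat (leq_trans _ hj)// addn2.
  move=> /Hy; apply: le_trans; rewrite exprMn; lra.
have pow0 : 0 < 2 ^+ j :> R by rewrite exprn_gt0.
have NE q : (q.+1 * 2 ^ j)%:R = q.+1%:R * 2 ^+ j :> R by rewrite natrM natrX.
have Nlow q : 2 ^+ j <= (q.+1 * 2 ^ j)%:R :> R.
  by rewrite NE ler_peMl ?ler1n// ltW.
have N0 q : (0 < q.+1 * 2 ^ j)%N by rewrite muln_gt0 expn_gt0.
have lnj0 : 0 < ln j%:R :> R by rewrite ln_gt0//; lra.
have lnj : ln j%:R <= j%:R :> R by rewrite ltW// ln_sublinear.
pose M := (16 * 2 ^ j)%N.
have M0 : (0 < M)%N by rewrite muln_gt0 expn_gt0.
pose E1 (k : 'I_16 * 'I_j.+1) := [set w | exists2 n, (n <= k.1.+1 * 2 ^ j)%N &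
  coarse_bound (k.1.+1 * 2 ^ j) j <= `|centered_count U n (k.2%:R / j%:R) w|].
pose E2 (k : 'I_16 * ('I_j * 'I_M.+1)) := [set w | exists2 n, (n <= k.1.+1 * 2 ^ j)%N &
  fine_bound (k.1.+1 * 2 ^ j) j
    <= `|centered_count U n ((k.2.1%:R + k.2.2%:R / M%:R) / j%:R) w
         - centered_count U n (k.2.1%:R / j%:R) w|].
have C1 k : covered P (E1 k) (2%:R * expR (- (5%:R / 2%:R * ln j%:R))).
  apply: (centered_count_deviation hU) => //.
  - by rewrite divr_ge0//= ler_pdivrMr// mul1r ler_nat -ltnS.
  - by rewrite mulr_gt0.
  - have := Nlow k.1; nra.
have C2 k : covered P (E2 k) (2%:R * expR (- (4%:R * j%:R))).
  have c0 : 0 <= k.2.1%:R / j%:R :> R by rewrite divr_ge0.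
  have e01 : 0 <= (k.2.2%:R / M%:R : R) <= 1.
    by rewrite divr_ge0//= ler_pdivrMr ?ltr0n// mul1r ler_nat -ltnS.
  case/andP: e01 => e0 e1.
  have c1 : k.2.1%:R + 1 <= j%:R :> R by rewrite natr1 ler_nat.
  apply: (centered_count_increment hU) => //.
  - by rewrite ler_pM2r ?invr_gt0// lerDl.
  - by rewrite ler_pdivrMr// mul1r; lra.
  - rewrite -mulrBl addrC addKr -[leRHS]mul1r ler_pM2r ?invr_gt0//.
  - by rewrite mulr_gt0.
  - by rewrite mulr_gt0 ?invr_gt0// ltr0n.
  - rewrite [leRHS]mulrA ler_pdivlMr//; have := Nlow k.1; nra.
apply: covered_le (coveredU (covered_card C1) (covered_card C2)).
- move=> w [n [s [nM s01 big_dev]]]; apply: contrapT => nE.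
  have qlt : (n %/ 2 ^ j < 16)%N by rewrite ltn_divLR ?expn_gt0.
  have nN : (n <= block_end n j)%N by rewrite ltnW// ltn_ceil ?expn_gt0.
  have : `|centered_count U n s w| <=
     coarse_bound (block_end n j) j + fine_bound (block_end n j) j + 1.
    apply: (@centered_count_grid _ _ _ _ n j M) => //.
    + exact: ltnW.
    + by rewrite mulr_ge0// sqrtr_ge0.
    + move=> c cj; rewrite leNgt; apply/negP => h; apply: nE; left.
      exists (Ordinal qlt, Ordinal (cj : (c < j.+1)%N)) => //.
      by exists n => //=; exact: ltW.
    + move=> c e cj eM; rewrite leNgt; apply/negP => h; apply: nE; right.
      exists (Ordinal qlt, (Ordinal cj, Ordinal (eM : (e < M.+1)%N))) => //.
      by exists n => //=; exact: ltW.
  by rewrite leNgt big_dev.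
rewrite !card_prod !card_ord.
have sj0 : 0 < Num.sqrt j%:R :> R by rewrite sqrtr_gt0.
have sj2 : Num.sqrt j%:R ^+ 2 = j%:R :> R by rewrite sqr_sqrtr// ltW.
set sj := Num.sqrt j%:R in sj0 sj2 *; clearbody sj.
have lnE : ln j%:R = 2%:R * ln sj :> R by rewrite -sj2 lnXn// mulr_natl.
have -> : expR (- (5%:R / 2%:R * ln j%:R)) = (j%:R * sj)^-1 * j%:R^-1 :> R.
  rewrite lnE (_ : 5%:R / 2%:R * _ = 5%:R * ln sj); last by field.
  rewrite expRN expRM_natl lnK// -invfM -sj2; congr (_^-1); ring.
have e3 : expR (- (4%:R * j%:R)) * 2 ^+ j <= (j%:R * sj)^-1 * j%:R^-1 :> R.
  have ej : j%:R <= expR j%:R :> R by have := expR_ge1Dx (j%:R : R); lra.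
  rewrite expRN mulrC ler_pdivrMr ?expR_gt0// expRM_natl.
  rewrite mulrC -invfM ler_pdivlMr ?mulr_gt0//.
  apply: (@le_trans _ _ (2 ^+ j * j%:R ^+ 3)).
    rewrite ler_wpM2l ?(ltW pow0)//.
    have : sj <= j%:R :> R by nra.
    nra.
  have -> : expR j%:R ^+ 4 = expR j%:R * expR j%:R ^+ 3 :> R by ring.
  apply: ler_pM => //; rewrite ?(ltW pow0) ?exprn_ge0//.
    exact: exp2_le_expR.
  by apply: lerXn2r; rewrite ?nnegrE ?expR_ge0.
set D := (j%:R * sj)^-1 in e3 *.
have D0 : 0 < D by rewrite invr_gt0 mulr_gt0.
have e3' : j%:R * (expR (- (4%:R * j%:R)) * 2 ^+ j) <= D.
  by rewrite mulrC -ler_pdivlMr.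
have dj : j%:R * (D * j%:R^-1) = D by rewrite mulrCA divff ?mulr1// gt_eqF.
have dj' : D * j%:R^-1 <= D / 2 by rewrite ler_pM2l// lef_pV2 ?posrE.
have Dj0 : 0 < D * j%:R^-1 by rewrite mulr_gt0// invr_gt0.
have MS : M.+1%:R <= 17%:R * 2 ^+ j :> R.
  rewrite -natr1 natrM natrX; have := exprn_ege1 j (ler1n R 2); lra.
have ex0 := expR_gt0 (- (4%:R * j%:R) : R).
rewrite !natrM -[j.+1%:R]natr1.
have T1 : 16%:R * (j%:R + 1) * (2%:R * (D * j%:R^-1)) <= 64%:R * D by nra.
have T2 : 16%:R * (j%:R * M.+1%:R) * (2%:R * expR (- (4%:R * j%:R))) <= 544%:R * D.
  apply: (@le_trans _ _ (16%:R * (j%:R * (17%:R * 2 ^+ j)) * (2%:R * expR (- (4%:R * j%:R))))).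
    by rewrite ler_wpM2r ?mulr_ge0 ?(ltW ex0)// !ler_wpM2l// ltW.
  have -> : 16%:R * (j%:R * (17%:R * 2 ^+ j)) * (2%:R * expR (- (4%:R * j%:R))) =
    544%:R * (j%:R * (expR (- (4%:R * j%:R)) * 2 ^+ j)) :> R by ring.
  apply: (ler_wpM2l (ler0n _ _)); exact: e3'.
lra.
Qed.

End lil_blocks.
Section lil.
Context (R : realType).

Lemma double_sqrt_le (A B c : R) : 0 <= c -> 4 * A <= c ^+ 2 * B ->
  2 * Num.sqrt A <= c * Num.sqrt B.
Proof.
move=> c0 h.
have -> : 2 * Num.sqrt A = Num.sqrt (4 * A).
  by rewrite sqrtrM// (_ : 4 = 2 ^+ 2) ?sqrtr_sqr ?ger0_norm//; ring.
have -> : c * Num.sqrt B = Num.sqrt (c ^+ 2 * B).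
  by rewrite sqrtrM ?sqr_ge0// sqrtr_sqr ger0_norm.
exact: ler_wsqrtr.
Qed.

Lemma near_lnln (A : R) : \forall n \near \oo, A <= ln (ln n%:R).
Proof.
near=> n.
have h : expR (expR A) <= n%:R by near: n; exact: nbhs_infty_ger.
have n0 : 0 < n%:R :> R by apply: lt_le_trans h; exact: expR_gt0.
have h1 : expR A <= ln n%:R by rewrite -[leLHS]expRK ler_ln ?posrE ?expR_gt0.
rewrite -[leLHS]expRK ler_ln ?posrE ?expR_gt0//.
exact: lt_le_trans (expR_gt0 _) h1.
Unshelve. all: by end_near. Qed.

Context d (T : measurableType d) (P : probability T R).
Context (U : nat -> T -> R).
Hypothesis hU : forall u a : R, 0 <= u <= 1 -> 0 <= a <= 1 ->
  iid_words P (fun i w => cell u a (U i w)) (cell_prob u a).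

(* The optimal constant is 2^(-1/2). *)
Lemma lil_centered_count :
  {ae P, forall w, \forall n \near \oo, forall s, 0 <= s <= 1 ->
    `|centered_count U n s w| <= 13%:R / 10%:R * Num.sqrt (n%:R * ln (ln n%:R))}.
Proof.
have [j0 Hj] := lil_block hU.
have := covered_borel_cantelli (n0 := j0.+1) (fun j h => Hj j (ltnW h)).
move=> /(_ (640%:R * 4)) H.
have {}H := H (fun N => _).
apply: filterS (H _) => [w [j1 hw]|N]; last first.
  by rewrite -mulr_sumr; apply: (ler_wpM2l (ler0n _ _)); exact: sum_inv_n_sqrt_le4.
near=> n.
(* 4 * 52/25 * 9/8 = 9.36 is below 4000 * 0.05^2 = 10, so the fine scale costs at most 0.05. *)
have l4 : (40 * 100) <= ln (ln n%:R) :> R by near: n; exact: near_lnln.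
have n10 : (10 <= n)%N by near: n; exact: nbhs_infty_ge.
have nj : (16 * 2 ^ j1.+1 <= n)%N by near: n; exact: nbhs_infty_ge.
move=> s s01; set l := ln (ln n%:R) in l4 *.
have n0 : (0 < n)%N by exact: leq_trans n10.
have nR : 10 <= n%:R :> R by rewrite (ler_nat _ 10).
(* Then 8 2^j <= n < 16 2^j, and the block of n ends at or before 9n/8. *)
pose j := (trunc_log 2 n - 3)%N.
have j3 : (3 <= trunc_log 2 n)%N.
  rewrite -(@trunc_expnK 2 3)//; apply: leq_trunc_log.
  by rewrite (leq_trans _ n10).
have jlo : (8 * 2 ^ j <= n)%N.
  rewrite (_ : 8 = 2 ^ 3)%N// -expnD subnKC//; exact: trunc_logP.
have jhi : (n < 16 * 2 ^ j)%N.
  by rewrite (_ : 16 = 2 ^ 4)%N// -expnD /j addnBA// addnC -addnBA// addn1 trunc_log_ltn.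
have jj1 : (j1 < j)%N.
  rewrite -(@ltn_exp2l 2)// -(@ltn_pmul2l 16)//.
  apply: leq_ltn_trans jhi; apply: leq_trans nj.
  by rewrite leq_mul2l leq_exp2l// leqnSn orbT.
have j_0 : (0 < j)%N by exact: leq_trans jj1.
have := hw j (ltnW jj1); rewrite /= => hB.
have {hB} B : `|centered_count U n s w| <=
    coarse_bound R (block_end n j) j + fine_bound R (block_end n j) j + 1.
  by rewrite leNgt; apply/negP => h; apply: hB; exists n, s.
apply: (le_trans B).
set N := block_end n j.
have N98 : N%:R <= 9%:R / 8%:R * n%:R :> R.
  have h1 : (N <= n + 2 ^ j)%N by rewrite /N /block_end mulSn addnC leq_add2r leq_divM.
  have h2 : (8 * N <= 9 * n)%N.
    rewrite (leq_trans (leq_mul (leqnn 8) h1))// mulnDr.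
    by rewrite (_ : 9 = 8 + 1)%N// mulnDl leq_add2l mul1n.
  by move: h2; rewrite -(ler_nat R) !natrM => h2; lra.
have jR0 : 0 < j%:R :> R by rewrite ltr0n.
have lnn0 : 0 < ln n%:R :> R by rewrite ln_gt0//; lra.
have lnj : ln j%:R <= 1 + l.
  have h1 : j%:R / 2 <= ln n%:R :> R.
    rewrite -[leLHS]expRK ler_ln ?posrE ?expR_gt0 ?ltr0n//.
    apply: le_trans (expR_half_le_exp2 R j) _.
    by rewrite -natrX ler_nat (leq_trans _ jlo)// leq_pmull.
  have h2 : j%:R <= expR 1 * ln n%:R :> R.
    have := expR_ge1Dx (1 : R); nra.
  rewrite -[1 in leRHS]expRK /l -lnM ?posrE ?expR_gt0//.
  by rewrite ler_ln ?posrE ?mulr_gt0 ?expR_gt0.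
have lnj0 : 0 <= ln j%:R :> R by rewrite ln_ge0// ler1n.
(* 4 * 13/25 * 9/8 * 1/4 * 5/2 = 1.4625 against 1.22^2 = 1.4884. *)
have c1 : coarse_bound R N j <= 122%:R / 100%:R * Num.sqrt (n%:R * l).
  apply: double_sqrt_le => //.
  have h : N%:R * ln j%:R <= 9%:R / 8%:R * n%:R * (1 + l).
    exact: (ler_pM (ler0n _ _) lnj0 N98 lnj).
  have h' : n%:R * (40 * 100) <= n%:R * l by rewrite ler_wpM2l.
  lra.
have c2 : fine_bound R N j <= 5%:R / 100%:R * Num.sqrt (n%:R * l).
  apply: double_sqrt_le => //.
  have -> : 13%:R / 25%:R * (N%:R * j%:R^-1) * (4%:R * j%:R) = 52%:R / 25%:R * N%:R :> R.
    by field; rewrite gt_eqF.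
  have h' : n%:R * (40 * 100) <= n%:R * l by rewrite ler_wpM2l.
  lra.
have c3 : 1 <= 1 / 100%:R * Num.sqrt (n%:R * l).
  rewrite -[1 in leLHS]sqrtr1 -[Num.sqrt 1]mul1r.
  suff : 2 * Num.sqrt 1 <= 2%:R / 100%:R * Num.sqrt (n%:R * l) by lra.
  apply: double_sqrt_le => //.
  have h' : 10 * (40 * 100) <= n%:R * l by apply: ler_pM.
  lra.
have := sqrtr_ge0 (n%:R * l); lra.
Unshelve. all: by end_near. Qed.

End lil.
(** * Oscillations *)

Section oscillation_cover.
Context d (T : measurableType d) (R : realType) (P : probability T R).
Context (U V : nat -> T -> R).
Hypothesis hUV : forall u a v b : R, 0 <= u <= 1 -> 0 <= a <= 1 ->
  0 <= v <= 1 -> 0 <= b <= 1 ->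
  iid_words P (fun i w => (cell u a (U i w), cell v b (V i w)))
    (fun c => cell_prob u a c.1 * cell_prob v b c.2).

Definition cross_sum (n : nat) (u a v b : R) (w : T) : R :=
  \sum_(i < n) zeta u v (cell u a (U i w), cell v b (V i w)).

(** Since |zeta| <= 3, Bernstein's condition has the factor 169 * 3^2 = 1521. The mean contributes
    at most n rho^2. *)
Lemma cross_sum_deviation (n : nat) (u a v b sigma rho x : R) :
  0 <= u <= 1 -> 0 <= a <= 1 -> 0 <= v <= 1 -> 0 <= b <= 1 ->
  u * (1 - u) <= sigma -> v * (1 - v) <= sigma ->
  `|a - u| <= rho -> `|b - v| <= rho ->
  let s2 := 2%:R * sigma * rho + 7%:R * rho ^+ 2 in
  0 < x -> 0 < n%:R * s2 -> 1521%:R * x <= 13%:R / 25%:R * (n%:R * s2) ->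
  covered P [set w | n%:R * rho ^+ 2
     + 2%:R * Num.sqrt (13%:R / 25%:R * (n%:R * s2) * x)
     <= `|cross_sum n u a v b w|] (2%:R * expR (- x)).
Proof.
move=> u01 a01 v01 b01 us vs ar br s2 x0 ns0 hx.
have p0 c : 0 <= cell_prob u a c.1 * cell_prob v b c.2.
  by rewrite mulr_ge0// cell_prob_ge0.
have p1 : \sum_c cell_prob u a c.1 * cell_prob v b c.2 = 1.
  have := sum_cell_prod (cell_prob u a) (cell_prob v b) (fun=> 1) (fun=> 1).
  under eq_bigr do rewrite mulr1 mulr1.
  move=> ->; under eq_bigr do rewrite mulr1.
  by rewrite sum_cell_prob mul1r; under eq_bigr do rewrite mulr1; rewrite sum_cell_prob.
have m2 : `|\sum_c cell_prob u a c.1 * cell_prob v b c.2 * zeta u v c| <= rho ^+ 2.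
  by rewrite zeta_mean normrM expr2 ler_pM.
have hx' : 169%:R * 3%:R ^+ 2 * x <= 13%:R / 25%:R * (n%:R * s2) by lra.
have := bernstein_maximal_abs (hUV u01 a01 v01 b01) p0 p1
  (fun c => zeta_le3 c u01 v01) m2
  (zeta_second_moment u01 a01 v01 b01 us vs ar br) x0 ns0 hx'.
apply: covered_le => //.
by move=> w h; exists n.
Qed.

(** A grid neighbour of i is encoded by an offset in 0 .. 2D, so that a pair costs (M + 1) (2D + 1)
    choices instead of (M + 1)^2. Truncated subtraction and the minimum with M keep every offset on
    the grid. *)
Lemma grid_offset (M i i' D : nat) (rho : R) : (0 < M)%N ->
  (i <= M)%N -> (i' <= M)%N -> D = Num.truncn (M%:R * rho) -> 0 <= rho ->
  `|i'%:R / M%:R - i%:R / M%:R| <= rho ->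
  exists2 e, (e <= D.*2)%N & i' = minn M (i + e - D).
Proof.
move=> M0 iM i'M DE rho0 h.
have MR : 0 < M%:R :> R by rewrite ltr0n.
have {}h : `|i'%:R - i%:R| <= M%:R * rho :> R.
  by move: h; rewrite -mulrBl normrM normfV [ `|M%:R| ]ger0_norm// ler_pdivrMr// mulrC.
have le (p q : nat) : (p <= q)%N -> `|q%:R - p%:R| <= M%:R * rho :> R -> (q - p <= D)%N.
  move=> pq hpq; rewrite DE truncn_ge_nat ?mulr_ge0//.
  by rewrite natrB// (le_trans _ hpq)// ler_norm.
have [ii'|i'i] := leqP i i'.
  have := le _ _ ii' h => hD; exists (D + (i' - i))%N.
    by rewrite -addnn leq_add2l.
  by rewrite addnCA addKn subnKC//; exact/esym/minn_idPr.
rewrite distrC in h; have := le _ _ (ltnW i'i) h => hD.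
exists (D - (i - i'))%N; first by rewrite -addnn (leq_trans (leq_subr _ _))// leq_addr.
have -> : (i + (D - (i - i')) - D)%N = i' by lia.
exact/esym/minn_idPr.
Qed.

Lemma cross_sum_grid_deviation (n M : nat) (sigma rho x : R) :
  (0 < M)%N -> 0 <= rho ->
  let s2 := 2%:R * sigma * rho + 7%:R * rho ^+ 2 in
  let D := Num.truncn (M%:R * rho) in
  0 < x -> 0 < n%:R * s2 -> 1521%:R * x <= 13%:R / 25%:R * (n%:R * s2) ->
  covered P [set w | exists i i' l l' : nat,
     [/\ [&& (i <= M)%N, (i' <= M)%N, (l <= M)%N & (l' <= M)%N],
         i%:R / M%:R * (1 - i%:R / M%:R) <= sigma /\
         l%:R / M%:R * (1 - l%:R / M%:R) <= sigma,
         `|i'%:R / M%:R - i%:R / M%:R| <= rho /\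
         `|l'%:R / M%:R - l%:R / M%:R| <= rho &
     n%:R * rho ^+ 2 + 2%:R * Num.sqrt (13%:R / 25%:R * (n%:R * s2) * x)
     <= `|cross_sum n (i%:R / M%:R) (i'%:R / M%:R) (l%:R / M%:R) (l'%:R / M%:R) w|]]
   ((M.+1 * D.*2.+1)%:R ^+ 2 * (2%:R * expR (- x))).
Proof.
move=> M0 rho0 s2 D x0 ns0 hx.
set t := _ + 2%:R * _.
pose g (k : nat) : R := k%:R / M%:R.
pose off (k : 'I_M.+1 * 'I_D.*2.+1) := minn M (k.1 + k.2 - D).
pose ok (k : ('I_M.+1 * 'I_D.*2.+1) * ('I_M.+1 * 'I_D.*2.+1)) :=
  [&& g k.1.1 * (1 - g k.1.1) <= sigma, g k.2.1 * (1 - g k.2.1) <= sigma,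
      `|g (off k.1) - g k.1.1| <= rho & `|g (off k.2) - g k.2.1| <= rho].
pose B k := [set w | ok k /\
  t <= `|cross_sum n (g k.1.1) (g (off k.1)) (g k.2.1) (g (off k.2)) w|].
have g01 k : (k <= M)%N -> 0 <= g k <= 1.
  by move=> kM; rewrite divr_ge0//= ler_pdivrMr ?ltr0n// mul1r ler_nat.
have offM k : (off k <= M)%N by exact: geq_minl.
have C k : covered P (B k) (2%:R * expR (- x)).
  have [/and4P[h1 h2 h3 h4]|nok] := boolP (ok k); last first.
    apply: covered_le (covered0 P (lexx 0)).
      by move=> w [okk _]; rewrite okk in nok.
    by rewrite mulr_ge0// expR_ge0.
  apply: covered_le (lexx _) (@cross_sum_deviation n _ _ _ _ sigma rho x
    (g01 _ _) (g01 _ (offM _)) (g01 _ _) (g01 _ (offM _)) h1 h2 h3 h4 x0 ns0 hx).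
  - by move=> w [].
  - by rewrite -ltnS.
  - by rewrite -ltnS.
apply: covered_le (covered_card C).
  move=> w [i [i' [l [l' [/and4P[iM i'M lM l'M] [s1 s2'] [r1 r2] h]]]]].
  have [e eD E1] := grid_offset M0 iM i'M erefl rho0 r1.
  have [f fD E2] := grid_offset M0 lM l'M erefl rho0 r2.
  exists ((Ordinal (iM : (i < M.+1)%N), Ordinal (eD : (e < D.*2.+1)%N)),
          (Ordinal (lM : (l < M.+1)%N), Ordinal (fD : (f < D.*2.+1)%N))) => //.
  by rewrite /B /ok /off /= -E1 -E2 /g s1 s2' r1 r2.
by rewrite !card_prod !card_ord natrM expr2.
Qed.

End oscillation_cover.

Section increments_cover.
Context d (T : measurableType d) (R : realType) (P : probability T R).
Context (U : nat -> T -> R).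
Hypothesis hU : forall u a : R, 0 <= u <= 1 -> 0 <= a <= 1 ->
  iid_words P (fun i w => cell u a (U i w)) (cell_prob u a).

Lemma grid_increment_deviation (n M : nat) (s2 x : R) : (0 < M)%N ->
  M%:R^-1 <= s2 -> 0 < x -> 0 < n%:R * s2 ->
  169%:R * x <= 13%:R / 25%:R * (n%:R * s2) ->
  covered P [set w | exists2 c, (c < M)%N &
     2%:R * Num.sqrt (13%:R / 25%:R * (n%:R * s2) * x) <=
     `|centered_count U n (c.+1%:R / M%:R) w - centered_count U n (c%:R / M%:R) w|]
   (M%:R * (2%:R * expR (- x))).
Proof.
move=> M0 Ms x0 ns0 hx.
have MR : 0 < M%:R :> R by rewrite ltr0n.
pose B (c : 'I_M) := [set w |
  2%:R * Num.sqrt (13%:R / 25%:R * (n%:R * s2) * x) <=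
   `|centered_count U n (c.+1%:R / M%:R) w - centered_count U n (c%:R / M%:R) w|].
have C c : covered P (B c) (2%:R * expR (- x)).
  apply: covered_le (lexx _) (@centered_count_increment _ _ _ _ _ hU
    (c%:R / M%:R) (c.+1%:R / M%:R) s2 x n _ _ _ _ x0 ns0 hx).
  - by move=> w h; exists n.
  - by rewrite divr_ge0.
  - by rewrite ler_pM2r ?invr_gt0// ler_nat.
  - by rewrite ler_pdivrMr// mul1r ler_nat.
  - by rewrite -mulrBl -natr1 addrAC subrr add0r mul1r.
apply: covered_le (covered_card C); last by rewrite card_ord.
by move=> w [c cM h]; exists (Ordinal cM).
Qed.

End increments_cover.

(** * Mesh, window and rate as functions of n *)

Section scale.
Context (R : realType).

(** About n^(3/4). A cell then contains of the order of n^(1/4) observations, so rounding is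
    negligible, though only by logarithmic factors. The unit 1/20 turns the exponents 3/4, 1/4 and
    36/10 into integers. *)
Definition grid_size (n : nat) : nat :=
  (Num.truncn (expR (ln n%:R / 20) ^+ 15 : R)).+1.

(* Slightly more than the bound on |a - u| given by [lil_centered_count]. *)
Definition window (n : nat) : R :=
  131%:R / 100%:R * Num.sqrt (ln (ln n%:R) / n%:R).

Definition osc_rate (n : nat) : R := Num.sqrt (n%:R * ln (ln n%:R)) * ln n%:R.

(* All the powers of n that occur are written as powers of y = n^(1/20). *)
Lemma near_scale (K : R) : \forall n \near \oo,
  let L := ln n%:R in let y := expR (L / 20) in
  [/\ n%:R = y ^+ 20, 1 <= ln L, ln L <= L, 1 <= y & K * L ^+ 2 <= y].
Proof.
have [x0 [x00 Hx]] := exprn_le_expR (K * 20 ^+ 2) 2.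
near=> n.
have l1 : 1 <= ln (ln n%:R) :> R by near: n; exact: near_lnln.
have n1 : (1 <= n)%N by near: n; exact: nbhs_infty_ge.
have Lx : 20 * x0 <= ln (ln n%:R) by near: n; exact: near_lnln.
set L := ln n%:R in l1 Lx *; set y := expR (L / 20).
have L0 : 0 < L.
  by rewrite ltNge; apply/negP => L0; rewrite ln0// in l1; lra.
have lL : ln L <= L by rewrite ltW// ln_sublinear.
apply: And5 => //.
- by rewrite -expRM_natl mulrC divfK// lnK// posrE ltr0n.
- by have := expR_ge1Dx (L / 20); rewrite -/y; lra.
- have /Hx : x0 <= L / 20 by lra.
  by rewrite (_ : K * 20 ^+ 2 * (L / 20) ^+ 2 = K * L ^+ 2)//; field.
Unshelve. all: by end_near. Qed.

Lemma grid_size_itv (n : nat) :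
  expR (ln n%:R / 20) ^+ 15 < ((grid_size n)%:R : R) <=
    expR (ln n%:R / 20) ^+ 15 + 1.
Proof.
rewrite /grid_size truncnS_gt/= -[(Num.truncn _).+1%:R]natr1 lerD2r.
by rewrite truncn_le exprn_ge0// expR_ge0.
Qed.

End scale.

(* 36/10 makes the union bound over the n^(2 + o(1)) quadruples of grid points
   summable. *)
Lemma oscillation_scale (R : realType) (sigma y L l n : R) :
  0 < sigma -> n = y ^+ 20 -> 1 <= y -> 1 <= l -> l <= L ->
  (1 + 100 * 100 / sigma) * L ^+ 2 <= y ->
  let rho := 131%:R / 100%:R * Num.sqrt (l / n) in
  let s2 := 2%:R * sigma * rho + 7%:R * rho ^+ 2 in
  [/\ 0 < n * s2,
      1521%:R * (36%:R / 10%:R * L) <= 13%:R / 25%:R * (n * s2) &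
      n * rho ^+ 2
        + 2%:R * Num.sqrt (13%:R / 25%:R * (n * s2) * (36%:R / 10%:R * L))
      <= 447%:R / 100%:R * Num.sqrt (sigma * (Num.sqrt (n * l) * L))].
Proof.
move=> sigma0 nE y1 l1 lL Ly rho s2.
have y0 : 0 < y.
  by lra.
have n0 : 0 < n.
  by rewrite nE exprn_gt0.
have L1 : 1 <= L.
  by lra.
pose sl := Num.sqrt l.
have sl1 : 1 <= sl.
  by rewrite -[leLHS]sqrtr1 ler_wsqrtr.
have sl2 : sl ^+ 2 = l.
  by rewrite sqr_sqrtr//; lra.
have slL : sl <= L.
  by rewrite (le_trans _ lL)// -sl2; nra.
have LLy : 100 * 100 * L ^+ 2 <= sigma * y.
  have h : (1 + 100 * 100 / sigma) * L ^+ 2 * sigma <= y * sigma by rewrite ler_pM2r.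
  have E : (1 + 100 * 100 / sigma) * L ^+ 2 * sigma = sigma * L ^+ 2 + 100 * 100 * L ^+ 2.
    by field; rewrite gt_eqF.
  have : 0 <= sigma * L ^+ 2 by rewrite mulr_ge0 ?sqr_ge0// ltW.
  by lra.
have yy10 : y <= y ^+ 10.
  by rewrite -[leLHS]expr1 ler_weXn2l.
have rhoE : rho = 131%:R / 100%:R * (sl / y ^+ 10).
  rewrite /rho /sl sqrtrM; last by lra.
  rewrite sqrtrV ?(ltW n0)// nE (_ : y ^+ 20 = (y ^+ 10) ^+ 2); last by rewrite -exprM.
  by rewrite sqrtr_sqr ger0_norm// exprn_ge0// ltW.
have nrho2 : n * rho ^+ 2 = 131%:R / 100%:R * (131%:R / 100%:R) * l.
  by rewrite rhoE nE -sl2; field; rewrite gt_eqF.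
have nrho : n * rho = 131%:R / 100%:R * (sl * y ^+ 10).
  by rewrite rhoE nE; field; rewrite gt_eqF.
have ns2E : n * s2 = 262%:R / 100%:R * (sigma * (sl * y ^+ 10))
    + 7%:R * (131%:R / 100%:R * (131%:R / 100%:R) * l).
  rewrite /s2 mulrDr (_ : n * (2%:R * sigma * rho) = 2%:R * sigma * (n * rho)); last by ring.
  rewrite (_ : n * (7%:R * rho ^+ 2) = 7%:R * (n * rho ^+ 2)); last by ring.
  by rewrite nrho nrho2; field.
have Lsy : 100 * 100 * L ^+ 2 <= sigma * (sl * y ^+ 10).
  apply: le_trans LLy _; rewrite ler_pM2l//.
  by nra.
have sqrtnl : Num.sqrt (n * l) = sl * y ^+ 10.
  rewrite mulrC sqrtrM; last by lra.
  rewrite nE (_ : y ^+ 20 = (y ^+ 10) ^+ 2); last by rewrite -exprM.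
  by rewrite sqrtr_sqr ger0_norm// exprn_ge0// ltW.
split.
- have LL : 1 <= L ^+ 2 by nra.
  rewrite ns2E; lra.
- have LL : L <= L ^+ 2 by rewrite expr2 ler_peMr//; lra.
  by rewrite ns2E; lra.
- rewrite sqrtnl; set q := sl * y ^+ 10.
  have hq : 100 * 100 * L ^+ 2 <= sigma * q := Lsy.
  have l2 : l <= L ^+ 2 by rewrite (le_trans lL)// expr2 ler_peMr//; lra.
  (* 4 * 0.52 * 2.62 * 3.6 is about 19.62, below 4.45^2 = 19.80; the rest absorbs the term in
     rho^2. *)
  have A1 : 2%:R * Num.sqrt (13%:R / 25%:R * (n * s2) * (36%:R / 10%:R * L))
      <= 445%:R / 100%:R * Num.sqrt (sigma * (q * L)).
    apply: double_sqrt_le => //.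
    rewrite (_ : sigma * (q * L) = sigma * q * L); last by ring.
    have h : 4 * (13%:R / 25%:R * (n * s2) * (36%:R / 10%:R))
        <= (445%:R / 100%:R) ^+ 2 * (sigma * q).
      by rewrite ns2E -/q; move: hq l2 l1; move: (sigma * q) => z; lra.
    have L0 : 0 <= L by lra.
    have := ler_wpM2r L0 h; lra.
  have A2 : 2 * Num.sqrt (l ^+ 2) <= 2%:R / 100%:R * Num.sqrt (sigma * (q * L)).
    apply: double_sqrt_le => //.
    have : l ^+ 2 <= L ^+ 2 by rewrite ler_pXn2r// ?nnegrE; lra.
    rewrite (_ : sigma * (q * L) = sigma * q * L); last by ring.
    have : sigma * q <= sigma * q * L.
      by rewrite ler_peMr//; have := sqr_ge0 L; lra.
    lra.
  have A3 : Num.sqrt (l ^+ 2) = l by rewrite sqrtr_sqr ger0_norm//; lra.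
  rewrite nrho2; move: A1 A2; rewrite A3; lra.
Qed.
Section oscillation_ae.
Context d (T : measurableType d) (R : realType) (P : probability T R).

Lemma near_covered_ae (B : nat -> set T) (K : R) : 0 <= K ->
  (\forall n \near \oo, covered P (B n) (K * (n%:R * Num.sqrt n%:R)^-1)) ->
  {ae P, forall w, \forall n \near \oo, ~ B n w}.
Proof.
move=> K0 [n0 _ h].
have := @covered_borel_cantelli _ _ _ P B
  (fun n => K * (n%:R * Num.sqrt n%:R)^-1) (K * 4) n0.+1.
move=> H; apply: filterS (H _ _).
- by move=> w [n1 hn1]; exists n1.
- by move=> n hn; apply: h; exact: ltnW.
- by move=> N; rewrite -mulr_sumr; apply: (ler_wpM2l K0); exact: sum_inv_n_sqrt_le4.
Qed.

Lemma sum_weight_scale (y n : R) : 1 <= y -> n = y ^+ 20 ->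
  n * Num.sqrt n = y ^+ 30.
Proof.
move=> y1 ->; rewrite (_ : y ^+ 20 = (y ^+ 10) ^+ 2); last by rewrite -exprM.
rewrite sqrtr_sqr ger0_norm ?exprn_ge0//; last lra.
ring.
Qed.

(** [M1] and [D1] stand for M + 1 and 2D + 1. The number of quadruples is at most 441 y^41, one
    factor y bounding log log n; dividing by y^72 = n^(36/10) leaves order y^(-31), better than
    y^(-30) = n^(-3/2). *)
Lemma grid_union_bound (y L l n M1 D1 : R) :
  1 <= y -> 1 <= l -> l <= L -> L ^+ 2 <= y -> n = y ^+ 20 ->
  0 <= M1 -> 0 <= D1 ->
  M1 <= y ^+ 15 + 2 ->
  D1 <= 2 * ((y ^+ 15 + 1) * (131%:R / 100%:R * Num.sqrt (l / n))) + 1 ->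
  (M1 * D1) ^+ 2 * (2 * (y ^+ 72)^-1) <= 1000%:R * (n * Num.sqrt n)^-1.
Proof.
move=> y1 l1 lL Ly nE M0 D0 hM hD.
have y0 : 0 < y by lra.
rewrite (sum_weight_scale y1 nE).
set sl := Num.sqrt l.
have sl1 : 1 <= sl by rewrite -[leLHS]sqrtr1 ler_wsqrtr.
have sl2 : sl ^+ 2 = l by rewrite sqr_sqrtr//; lra.
have ly : l <= y by nra.
have Y k : 1 <= y ^+ k by rewrite exprn_ege1.
have sE : Num.sqrt (l / n) = sl / y ^+ 10.
  rewrite sqrtrM; last by lra.
  rewrite sqrtrV nE ?exprn_ge0 ?(ltW y0)//.
  rewrite (_ : y ^+ 20 = (y ^+ 10) ^+ 2); last by rewrite -exprM.
  by rewrite sqrtr_sqr ger0_norm// exprn_ge0// ltW.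
have hM' : M1 <= 3 * y ^+ 15 by have := Y 15; lra.
have hD' : D1 <= 7%:R * (sl * y ^+ 5).
  apply: (le_trans hD); rewrite sE.
  have h : (y ^+ 15 + 1) * (131%:R / 100%:R * (sl / y ^+ 10)) <=
      2 * y ^+ 15 * (131%:R / 100%:R * (sl / y ^+ 10)).
    apply: ler_wpM2r; last by have := Y 15; lra.
    by rewrite mulr_ge0// divr_ge0// ?exprn_ge0 ?(ltW y0)//; lra.
  have E : 2 * y ^+ 15 * (131%:R / 100%:R * (sl / y ^+ 10)) = 262%:R / 100%:R * (sl * y ^+ 5).
    by field; rewrite gt_eqF.
  have : 1 <= sl * y ^+ 5 by rewrite mulr_ege1.
  lra.
have hP : M1 * D1 <= 21%:R * (sl * y ^+ 20).
  rewrite (_ : 21%:R * (sl * y ^+ 20) = 3 * y ^+ 15 * (7%:R * (sl * y ^+ 5))); last by ring.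
  exact: ler_pM.
have hP2 : (M1 * D1) ^+ 2 <= 441%:R * (y * y ^+ 40).
  apply: (@le_trans _ _ ((21%:R * (sl * y ^+ 20)) ^+ 2)).
    by rewrite ler_pXn2r// nnegrE mulr_ge0// mulr_ge0 ?exprn_ge0 ?(ltW y0)//; lra.
  rewrite (_ : (21%:R * (sl * y ^+ 20)) ^+ 2 = 441%:R * (sl ^+ 2 * y ^+ 40)); last by ring.
  rewrite sl2; apply: ler_wpM2l; first exact: ler0n.
  by rewrite ler_wpM2r// exprn_ge0// ltW.
rewrite mulrA ler_pdivrMr ?exprn_gt0//.
rewrite (_ : 1000%:R / y ^+ 30 * y ^+ 72 = 1000%:R * (y * y ^+ 41)); last first.
  by field; rewrite gt_eqF.
have : y * y ^+ 40 <= y * y ^+ 41.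
  by rewrite ler_pM2l// ler_weXn2l.
have := exprn_ge0 40 (ltW y0) ; have := exprn_ge0 41 (ltW y0).
move: (y ^+ 40) (y ^+ 41) hP2 => a b hP2 a0 b0 ab.
have : 0 <= y * b by rewrite mulr_ge0// ltW.
lra.
Qed.

Context (U V : nat -> T -> R).

Lemma oscillation_grid_ae (sigma : R) : 0 < sigma ->
  (forall u a v b : R, 0 <= u <= 1 -> 0 <= a <= 1 ->
    0 <= v <= 1 -> 0 <= b <= 1 ->
    iid_words P (fun i w => (cell u a (U i w), cell v b (V i w)))
      (fun c => cell_prob u a c.1 * cell_prob v b c.2)) ->
  {ae P, forall w, \forall n \near \oo,
   let M := grid_size R n in
   forall i i' l l' : nat,
     [&& (i <= M)%N, (i' <= M)%N, (l <= M)%N & (l' <= M)%N] ->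
     i%:R / M%:R * (1 - i%:R / M%:R) <= sigma ->
     l%:R / M%:R * (1 - l%:R / M%:R) <= sigma ->
     `|i'%:R / M%:R - i%:R / M%:R| <= window R n ->
     `|l'%:R / M%:R - l%:R / M%:R| <= window R n ->
     `|cross_sum U V n (i%:R / M%:R) (i'%:R / M%:R)
         (l%:R / M%:R) (l'%:R / M%:R) w|
       <= 447%:R / 100%:R * Num.sqrt (sigma * osc_rate R n)}.
Proof.
move=> sigma0 hUV.
pose M := grid_size R; pose g n (i : nat) : R := i%:R / (M n)%:R.
pose B n := [set w | exists i i' l l' : nat,
  [/\ [&& (i <= M n)%N, (i' <= M n)%N, (l <= M n)%N & (l' <= M n)%N],
      g n i * (1 - g n i) <= sigma /\ g n l * (1 - g n l) <= sigma,
      `|g n i' - g n i| <= window R n /\ `|g n l' - g n l| <= window R n &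
      447%:R / 100%:R * Num.sqrt (sigma * osc_rate R n)
        <= `|cross_sum U V n (g n i) (g n i') (g n l) (g n l') w|]].
have := @near_covered_ae B 1000%:R (ler0n _ _).
move=> H; apply: filterS (H _).
  move=> w; apply: filterS => n nB i i' l l' hM s1 s2 r1 r2.
  rewrite leNgt; apply/negP => /ltW h; apply: nB.
  by exists i, i', l, l'; split.
near=> n.
have [nE l1 lL y1 Ky] : let L := ln n%:R in let y := expR (L / 20) in
  [/\ n%:R = y ^+ 20, 1 <= ln L, ln L <= L, 1 <= y &
      (1 + 100 * 100 / sigma) * L ^+ 2 <= y].
  by near: n; exact: near_scale.
have [v0 vL th] := oscillation_scale sigma0 nE y1 l1 lL Ky.
have M0 : (0 < grid_size R n)%N by [].
have w0 : 0 <= window R n by rewrite mulr_ge0 ?sqrtr_ge0// divr_ge0.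
have x0 : 0 < 36%:R / 10%:R * ln n%:R :> R by lra.
have := cross_sum_grid_deviation hUV M0 w0 x0 v0 vL.
apply: covered_le.
  move=> w [i [i' [l [l' [h1 h2 h3 h4]]]]]; exists i, i', l, l'; split => //.
  exact: le_trans h4.
have Ly : ln n%:R ^+ 2 <= expR (ln n%:R / 20) :> R.
  apply: le_trans Ky; rewrite ler_peMl ?sqr_ge0// lerDl divr_ge0//; lra.
have -> : expR (- (36%:R / 10%:R * ln n%:R)) = (expR (ln n%:R / 20) ^+ 72)^-1 :> R.
  by rewrite expRN -expRM_natl; congr (expR _)^-1; field.
rewrite natrM.
have /andP[M1 M2] := grid_size_itv R n.
apply: (grid_union_bound y1 l1 lL Ly nE) => //.
  by rewrite -natr1; lra.
rewrite -natr1 lerD2r -muln2 natrM mulrC ler_pM2l//.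
apply: (@le_trans _ _ ((grid_size R n)%:R * window R n)).
  by rewrite truncn_le mulr_ge0.
by rewrite ler_wpM2r.
Unshelve. all: by end_near. Qed.

(** Controls the number of observations in each cell, which is what rounding to the grid costs. *)
Lemma grid_increment_ae :
  (forall u a : R, 0 <= u <= 1 -> 0 <= a <= 1 ->
    iid_words P (fun i w => cell u a (U i w)) (cell_prob u a)) ->
  {ae P, forall w, \forall n \near \oo,
   let M := grid_size R n in
   forall c, (c < M)%N ->
     `|centered_count U n (c.+1%:R / M%:R) w - centered_count U n (c%:R / M%:R) w|
       <= expR (ln n%:R / 20) ^+ 5}.
Proof.
move=> hU.
pose g n (i : nat) : R := i%:R / (grid_size R n)%:R.
pose B n := [set w | exists2 c, (c < grid_size R n)%N &
  expR (ln n%:R / 20) ^+ 5 <=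
    `|centered_count U n (g n c.+1) w - centered_count U n (g n c) w|].
have := @near_covered_ae B 4%:R (ler0n _ _).
move=> H; apply: filterS (H _).
  move=> w; apply: filterS => n nB c cM.
  by rewrite leNgt; apply/negP => /ltW h; apply: nB; exists c.
near=> n.
have [nE l1 lL y1 Ky] : let L : R := ln n%:R in let y := expR (L / 20) in
  [/\ n%:R = y ^+ 20, 1 <= ln L, ln L <= L, 1 <= y & (50 * 20) * L ^+ 2 <= y].
  by near: n; exact: near_scale.
have /andP[M1 M2] := grid_size_itv R n.
have M0 : (0 < grid_size R n)%N by [].
set L := ln n%:R in nE l1 lL y1 Ky M1 M2 *.
set y := expR (L / 20) in nE y1 Ky M1 M2 *.
have y0 : 0 < y by lra.
have Y k : 1 <= y ^+ k by rewrite exprn_ege1.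
have L1 : 1 <= L by lra.
have LL : L <= L ^+ 2 by rewrite expr2 ler_peMr//; lra.
have s2E : n%:R * (y ^+ 12)^-1 = y ^+ 8 by rewrite nE; field; rewrite gt_eqF.
have yy k : (0 < k)%N -> y <= y ^+ k by move=> k0; rewrite -[leLHS]expr1 ler_weXn2l.
have c1 : (grid_size R n)%:R^-1 <= (y ^+ 12)^-1.
  rewrite lef_pV2 ?posrE ?ltr0n ?exprn_gt0//.
  by apply: (@le_trans _ _ (y ^+ 15)); [rewrite ler_weXn2l|exact: ltW].
(* The variance bound n^(-3/5) exceeds the cell length, but the target n^(1/4) leaves room: n s2 =
   y^8, and the squared threshold, of order L y^8, is below y^10. *)
have := @grid_increment_deviation _ _ _ _ _ hU n (grid_size R n) (y ^+ 12)^-1 (3 * L) M0 c1.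
rewrite s2E => /(_ _ _ _) G.
have x0 : 0 < 3 * L by lra.
have v0 : 0 < y ^+ 8 by rewrite exprn_gt0.
have vL : 169%:R * (3 * L) <= 13%:R / 25%:R * y ^+ 8 by have := yy 8 isT; lra.
apply: covered_le (G x0 v0 vL).
  move=> w [c cM h]; exists c => //; apply: le_trans h.
  have -> : y ^+ 5 = 1 * Num.sqrt (y ^+ 10).
    rewrite mul1r (_ : y ^+ 10 = (y ^+ 5) ^+ 2); last by rewrite -exprM.
    by rewrite sqrtr_sqr ger0_norm// exprn_ge0// ltW.
  apply: double_sqrt_le => //.
  have := ler_wpM2r (ltW v0) (yy 2 isT).
  have -> : y ^+ 2 * y ^+ 8 = y ^+ 10 by ring.
  have := ler_wpM2r (ltW v0) Ky; have := ler_wpM2r (ltW v0) LL.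
  have : 0 <= L ^+ 2 * y ^+ 8 by rewrite mulr_ge0 ?sqr_ge0// ltW.
  lra.
have -> : expR (- (3 * L)) = (y ^+ 60)^-1.
  by rewrite expRN -expRM_natl; congr (expR _)^-1; field.
rewrite (sum_weight_scale y1 nE).
rewrite mulrA ler_pdivrMr ?exprn_gt0//.
have -> : 4%:R / y ^+ 30 * y ^+ 60 = 4%:R * y ^+ 30 by field; rewrite gt_eqF.
have : y ^+ 15 <= y ^+ 30 by rewrite ler_weXn2l.
have := Y 15; lra.
Unshelve. all: by end_near. Qed.

End oscillation_ae.
(** * The deterministic comparison *)

Section discretization.
Context (R : realType) d (T : measurableType d) (U V : nat -> T -> R).
Context (n M : nat) (B : R) (w : T).
Hypothesis M0 : (0 < M)%N.
Hypothesis nMB : n%:R / M%:R <= B.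

(** The observations between s and its floor lie in one cell, whose count is its mean n / M plus a
    centered increment, each at most B. *)
Lemma count_floor (W : nat -> T -> R) (s : R) : 0 <= s <= 1 ->
  (forall c, (c < M)%N ->
    `|centered_count W n (c.+1%:R / M%:R) w - centered_count W n (c%:R / M%:R) w| <= B) ->
  exists c : nat, [/\ (c <= M)%N, 0 <= s - c%:R / M%:R <= M%:R^-1 &
    \sum_(i < n) ((W i w <= s)%R%:R - (W i w <= c%:R / M%:R)%R%:R) <= 2 * B].
Proof.
move=> /andP[s0 s1] hB.
have MR : 0 < M%:R :> R by rewrite ltr0n.
have B0 : 0 <= B by apply: le_trans nMB; rewrite divr_ge0.
have [->|s1'] := eqVneq s 1.
  exists M; rewrite divff ?gt_eqF// subrr lexx invr_ge0 ltW//; split => //.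
  by rewrite big1 ?mulr_ge0// => i _; rewrite subrr.
have [|c cM /andP[cs sc]] := truncn_grid M0 s0 _.
  by rewrite lt_neqAle s1'.
exists c; split; first exact: ltnW.
  rewrite subr_ge0 cs/= lerBlDl (le_trans (ltW sc))// -natr1 mulrDl mul1r//.
have E : \sum_(i < n) ((W i w <= s)%R%:R - (W i w <= c%:R / M%:R)%R%:R) =
   centered_count W n s w - centered_count W n (c%:R / M%:R) w + n%:R * (s - c%:R / M%:R).
  have -> : n%:R * (s - c%:R / M%:R) = \sum_(i < n) (s - c%:R / M%:R).
    by rewrite sumr_const card_ord mulr_natl.
  rewrite /centered_count -sumrB -big_split/=.
  by apply: eq_bigr => i _; ring.
rewrite E.
have := centered_count_le W n w (ltW sc).
have := le_trans (ler_norm _) (hB c cM).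
have -> : n%:R * (c.+1%:R / M%:R - s) =
    n%:R / M%:R - n%:R * (s - c%:R / M%:R) :> R.
  by rewrite -natr1; field; rewrite gt_eqF.
move: nMB; lra.
Qed.

(** Rounding the levels down can only turn indicators off, so the differences are nonnegative and
    can later be summed as counts. Each indicator occurs once in a product and once in a linear
    term, hence the factor 2. *)
Lemma zeta_perturbation (u v u' v' : R) (p0 p q0 q p0' p' q0' q' : bool) :
  0 <= u <= 1 -> 0 <= v <= 1 -> (p0' ==> p0) -> (p' ==> p) -> (q0' ==> q0) -> (q' ==> q) ->
  `|zeta u v ((p0, p), (q0, q)) - zeta u' v' ((p0', p'), (q0', q'))| <=
   2 * ((p%:R - p'%:R) + (p0%:R - p0'%:R) + ((q%:R - q'%:R) + (q0%:R - q0'%:R)))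
   + (`|u - u'| + `|v - v'|).
Proof.
move=> u01 v01 h0 h1 h2 h3.
have prod (a b a' b' : bool) : (a' ==> a) -> (b' ==> b) ->
    `|(a%:R * b%:R - a'%:R * b'%:R : R)| <= (a%:R - a'%:R) + (b%:R - b'%:R).
  case: a; case: b; case: a'; case: b' => // _ _ /=;
    rewrite ler_norml; apply/andP; split; lra.
have lin (r r' : R) (a b a' b' : bool) : 0 <= r <= 1 -> (a' ==> a) -> (b' ==> b) ->
    `|r * (a%:R - b%:R) - r' * (a'%:R - b'%:R)| <=
       (a%:R - a'%:R) + (b%:R - b'%:R) + `|r - r'|.
  move=> /andP[r0 r1] ha hb.
  have := ler_norm (r - r'); have := ler_norm (r' - r); rewrite distrC.
  move: ha hb; case: a; case: b; case: a'; case: b' => // _ _ /=;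
    rewrite ler_norml => ? ?; apply/andP; split; lra.
have E1 := prod _ _ _ _ h1 h3; have E2 := prod _ _ _ _ h0 h2.
have E3 := lin u u' _ _ _ _ u01 h3 h2; have E4 := lin v v' _ _ _ _ v01 h1 h0.
have -> : zeta u v ((p0, p), (q0, q)) - zeta u' v' ((p0', p'), (q0', q')) =
  (p%:R * q%:R - p'%:R * q'%:R) - (p0%:R * q0%:R - p0'%:R * q0'%:R)
  - (u * (q%:R - q0%:R) - u' * (q'%:R - q0'%:R))
  - (v * (p%:R - p0%:R) - v' * (p'%:R - p0'%:R)).
  by rewrite /zeta/=; ring.
apply: le_trans (ler_normB _ _) _.
apply: le_trans (lerD (ler_normB _ _) (lexx _)) _.
apply: le_trans (lerD (lerD (ler_normB _ _) (lexx _)) (lexx _)) _.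
lra.
Qed.

(** Four levels, each costing 2 B with weight 2, and at most 2 n / M from the coefficients u and v:
    18 = 4 * 2 * 2 + 2. *)
Lemma cross_sum_floor (u a v b : R) :
  (forall c, (c < M)%N ->
    `|centered_count U n (c.+1%:R / M%:R) w - centered_count U n (c%:R / M%:R) w| <= B) ->
  (forall c, (c < M)%N ->
    `|centered_count V n (c.+1%:R / M%:R) w - centered_count V n (c%:R / M%:R) w| <= B) ->
  0 <= u <= 1 -> 0 <= a <= 1 -> 0 <= v <= 1 -> 0 <= b <= 1 ->
  exists i i' l l' : nat,
   [/\ [&& (i <= M)%N, (i' <= M)%N, (l <= M)%N & (l' <= M)%N],
       0 <= u - i%:R / M%:R <= M%:R^-1 /\ 0 <= a - i'%:R / M%:R <= M%:R^-1,
       0 <= v - l%:R / M%:R <= M%:R^-1 /\ 0 <= b - l'%:R / M%:R <= M%:R^-1 &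
   `|cross_sum U V n u a v b w - cross_sum U V n (i%:R / M%:R) (i'%:R / M%:R)
       (l%:R / M%:R) (l'%:R / M%:R) w| <= 18%:R * B].
Proof.
move=> hU hV u01 a01 v01 b01.
have [i [iM ui Ni]] := count_floor u01 hU.
have [i' [i'M ai Ni']] := count_floor a01 hU.
have [l [lM vl Nl]] := count_floor v01 hV.
have [l' [l'M bl Nl']] := count_floor b01 hV.
exists i, i', l, l'; split; rewrite ?iM ?i'M ?lM ?l'M//.
rewrite /cross_sum -sumrB; apply: le_trans (ler_norm_sum _ _ _) _.
have imp (W s c : R) : 0 <= s - c -> (W <= c) ==> (W <= s).
  by rewrite subr_ge0 => cs; apply/implyP => Wc; exact: le_trans cs.
apply: (@le_trans _ _ (\sum_(k < n)
   (2 * (((U k w <= a)%R%:R - (U k w <= i'%:R / M%:R)%R%:R) +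
         ((U k w <= u)%R%:R - (U k w <= i%:R / M%:R)%R%:R) +
        (((V k w <= b)%R%:R - (V k w <= l'%:R / M%:R)%R%:R) +
         ((V k w <= v)%R%:R - (V k w <= l%:R / M%:R)%R%:R)))
    + (`|u - i%:R / M%:R| + `|v - l%:R / M%:R|)))).
  apply: ler_sum => k _; apply: zeta_perturbation => //; apply: imp.
  - by case/andP: ui.
  - by case/andP: ai.
  - by case/andP: vl.
  - by case/andP: bl.
rewrite big_split/= -mulr_sumr [X in _ + X]sumr_const card_ord.
rewrite -[X in _ + X]mulr_natl !big_split/=.
have h : n%:R * (`|u - i%:R / M%:R| + `|v - l%:R / M%:R|) <= 2 * B.
  apply: (@le_trans _ _ (n%:R * (M%:R^-1 + M%:R^-1))).
    case/andP: ui => ui0 ui1; case/andP: vl => vl0 vl1.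
    by rewrite ler_wpM2l// lerD// ger0_norm.
  by move: nMB; lra.
rewrite !big_split/= in Ni Ni' Nl Nl'; lra.
Qed.

End discretization.

(** * Empirical quantiles on the uniform scale *)

Section quantiles.
Context (R : realType) (n : nat) (x : nat -> R).

Lemma ecdf_ge (s u : R) : (0 < n)%N ->
  (u <= ecdf n x s) = (n%:R * u <= \sum_(i < n) (x i <= s)%R%:R).
Proof. by move=> n0; rewrite /ecdf ler_pdivlMl ?ltr0n. Qed.

(* If [s] lies in the upper set that defines the quantile, so does the largest
   observation below [s]; hence the infimum is attained at an observation. *)
Lemma equantile_attained (u : R) : (0 < n)%N -> 0 < u -> u <= 1 ->
  (forall i j, (i < n)%N -> (j < n)%N -> i != j -> x i != x j) ->
  exists2 i0, (i0 < n)%N & equantile n x u = (x i0)%:E /\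
    `|\sum_(i < n) (x i <= x i0)%R%:R - n%:R * u| <= 1.
Proof.
move=> n0 u0 u1 xinj.
have cnt_le (s t : R) : (forall i : 'I_n, x i <= s -> x i <= t) ->
    \sum_(i < n) (x i <= s)%R%:R <= \sum_(i < n) (x i <= t)%R%:R :> R.
  move=> st; apply: ler_sum => i _; rewrite ler_nat.
  by case: (leP (x i) s) => // /st ->.
have nu0 : 0 < n%:R * u by rewrite mulr_gt0// ltr0n.
have below (s : R) : 0 < \sum_(i < n) (x i <= s)%R%:R :> R ->
    exists2 j : 'I_n, x j <= s & forall i : 'I_n, x i <= s -> x i <= x j.
  move=> spos.
  have [i1 i1s] : exists i1 : 'I_n, x i1 <= s.
    apply: contrapT => /forallNP none; move: spos.
    by rewrite big1 ?ltxx// => i _; case: leP => // /none.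
  have [j js jmax] := @arg_maxP _ _ _ i1 (fun i : 'I_n => x i <= s) (fun i : 'I_n => x i) i1s.
  by exists j.
pose i1 : 'I_n := Ordinal n0.
have [m _ mmax] := @arg_maxP _ _ _ i1 xpredT (fun i : 'I_n => x i) isT.
pose Q (i : 'I_n) := u <= ecdf n x (x i).
have Qm : Q m.
  rewrite /Q ecdf_ge// (eq_bigr (fun=> 1)) => [|i _]; last by rewrite [_ <= _]mmax.
  by rewrite sumr_const card_ord ler_piMr.
have [i0 Qi0 i0min] := @arg_minP _ _ _ m Q (fun i : 'I_n => x i) Qm.
have lb (s : R) : u <= ecdf n x s -> x i0 <= s.
  rewrite ecdf_ge// => us.
  have [j js jmax] := below s (lt_le_trans nu0 us).
  apply: le_trans (i0min j _) js; rewrite /Q ecdf_ge//.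
  by apply: le_trans us _; exact: cnt_le.
exists i0 => //; split.
  apply/eqP; rewrite eq_le; apply/andP; split.
    by apply: ereal_inf_lbound; exists (x i0).
  by apply: le_ereal_inf_tmp => _ [s /= us <-]; rewrite lee_fin; exact: lb.
have lo : n%:R * u <= \sum_(i < n) (x i <= x i0)%R%:R by rewrite -ecdf_ge.
have split_eq : \sum_(i < n) (x i <= x i0)%R%:R = 1 + \sum_(i < n) (x i < x i0)%R%:R :> R.
  rewrite (bigD1 i0)//= lexx; congr (_ + _).
  rewrite [RHS](bigD1 i0)//= ltxx add0r; apply: eq_bigr => i ii0.
  by rewrite lt_neqAle xinj.
(* Otherwise the largest observation strictly below [x i0] would already belong to the upper set,
   against the minimality of [x i0]. *)
have hi : \sum_(i < n) (x i < x i0)%R%:R < n%:R * u :> R.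
  rewrite ltNge; apply/negP => us.
  have [i2 i2i0] : exists i2 : 'I_n, x i2 < x i0.
    apply: contrapT => /forallNP none; move: (lt_le_trans nu0 us).
    by rewrite big1 ?ltxx// => i _; case: ltP => // /none.
  have [j ji0 jmax] := @arg_maxP _ _ _ i2 (fun i : 'I_n => x i < x i0)
    (fun i : 'I_n => x i) i2i0.
  have : Q j.
    rewrite /Q ecdf_ge// (le_trans us)//; apply: ler_sum => i _; rewrite ler_nat.
    by case: (ltP (x i) (x i0)) => // /jmax ij; rewrite (ij : x i <= x j).
  by move=> /i0min; rewrite leNgt ji0.
rewrite ler_norml; apply/andP; split; lra.
Qed.

(** G may be flat, but its values on the sample are distinct, so it preserves and reflects the order
    there, and a is G of the quantile. For u = 0 the quantile is -oo, and a = 0 works because all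
    these values are positive. *)
Lemma equantile_uniform (G : R -> R) (u : R) : (0 < n)%N -> 0 <= u <= 1 ->
  {homo G : s t / s <= t} -> (forall i, 0 < G (x i) <= 1) ->
  (forall i j, i != j -> G (x i) != G (x j)) ->
  exists a, [/\ 0 <= a <= 1,
    forall i, (i < n)%N -> ((x i)%:E <= equantile n x u)%E = (G (x i) <= a) &
    `|\sum_(i < n) (G (x i) <= a)%R%:R - n%:R * u| <= 1].
Proof.
move=> n0 /andP[u0 u1] Gnd G01 Ginj.
have [u0'|u0'] := eqVneq u 0.
  exists 0; split; first by rewrite lexx ler01.
  - move=> i _; have /andP[Gi _] := G01 i.
    rewrite [RHS]leNgt Gi /=.
    have -> : equantile n x u = -oo%E.
      rewrite -ereal_inf_real u0'; congr ereal_inf; apply/seteqP.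
      split => _ [s _ <-]; exists s => //=.
      by rewrite mulr_ge0// ?invr_ge0// sumr_ge0.
    by [].
  - rewrite big1 ?u0' ?mulr0 ?subrr ?normr0// => i _.
    by have /andP[Gi _] := G01 i; rewrite leNgt Gi.
have [] := @equantile_attained u n0 _ u1.
- by rewrite lt_neqAle eq_sym u0'.
- by move=> i j _ _ ij; apply: contra_neq (Ginj i j ij) => ->.
move=> i0 i0n [-> cnt]; have cmp i : (x i <= x i0) = (G (x i) <= G (x i0)).
  apply/idP/idP => [|Gi]; first exact: Gnd.
  rewrite leNgt; apply/negP => xi.
  have ii0 : i != i0 by apply: contraTneq xi => ->; rewrite ltxx.
  have : G (x i) == G (x i0) by rewrite eq_le Gi Gnd// ltW.
  by apply/negP; exact: Ginj.
exists (G (x i0)); split.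
- by have /andP[/ltW-> ->] := G01 i0.
- by move=> i _; rewrite lee_fin cmp.
- by under eq_bigr do rewrite -cmp.
Qed.

End quantiles.

Section copula_identity.
Context (R : realType) d (T : measurableType d).

(** The difference equals n^(-1/2) times [cross_sum] + u (N_b - n v) + v (N_a - n u), where N_a and
    N_b count the observations up to a and b. By the choice of a and b both brackets are at most 1
    in absolute value. *)
Lemma copula_process_approx (n : nat) (x y : nat -> R) (G H : R -> R)
    (U V : nat -> T -> R) (w : T) (u v : R) :
  (0 < n)%N -> 0 <= u <= 1 -> 0 <= v <= 1 ->
  {homo G : s t / s <= t} -> {homo H : s t / s <= t} ->
  (forall i, 0 < G (x i) <= 1) -> (forall i, 0 < H (y i) <= 1) ->
  (forall i j, i != j -> G (x i) != G (x j)) ->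
  (forall i j, i != j -> H (y i) != H (y j)) ->
  (forall i, U i w = G (x i)) -> (forall i, V i w = H (y i)) ->
  exists a b : R, [/\ 0 <= a <= 1 /\ 0 <= b <= 1,
    `|centered_count U n a w + n%:R * (a - u)| <= 1,
    `|centered_count V n b w + n%:R * (b - v)| <= 1 &
    `|copula_process n x y u v - alpha n (G \o x) (H \o y) u v
      + u * alphaV n (G \o x) (H \o y) v + v * alphaU n (G \o x) (H \o y) u|
     <= (Num.sqrt n%:R)^-1 * (`|cross_sum U V n u a v b w| + 2)].
Proof.
move=> n0 u01 v01 Gnd Hnd G01 H01 Ginj Hinj UE VE.
have [a [a01 aE aC]] := equantile_uniform n0 u01 Gnd G01 Ginj.
have [b [b01 bE bC]] := equantile_uniform n0 v01 Hnd H01 Hinj.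
have nR : 0 < n%:R :> R by rewrite ltr0n.
have cc (W : nat -> T -> R) s t : centered_count W n s w + n%:R * (s - t) =
    \sum_(i < n) (W i w <= s)%R%:R - n%:R * t.
  rewrite /centered_count sumrB sumr_const card_ord -mulr_natl; ring.
exists a, b; split => //.
- by rewrite cc; under eq_bigr do rewrite UE.
- by rewrite cc; under eq_bigr do rewrite VE.
have sn0 : 0 < Num.sqrt n%:R :> R by rewrite sqrtr_gt0.
have snn : Num.sqrt n%:R ^+ 2 = n%:R :> R by rewrite sqr_sqrtr.
pose Nab := \sum_(i < n) ((G (x i) <= a)%R && (H (y i) <= b)%R)%:R : R.
pose Nuv := \sum_(i < n) ((G (x i) <= u)%R && (H (y i) <= v)%R)%:R : R.
pose Na := \sum_(i < n) (G (x i) <= a)%R%:R : R.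
pose Nu := \sum_(i < n) (G (x i) <= u)%R%:R : R.
pose Nb := \sum_(i < n) (H (y i) <= b)%R%:R : R.
pose Nv := \sum_(i < n) (H (y i) <= v)%R%:R : R.
have ZE : cross_sum U V n u a v b w = Nab - Nuv - u * (Nb - Nv) - v * (Na - Nu).
  rewrite /cross_sum /Nab /Nuv /Nb /Nv /Na /Nu -!sumrB !mulr_sumr -!sumrB.
  apply: eq_bigr => i _; rewrite /zeta /cell/= !UE !VE.
  by rewrite -!natrM !mulnb.
have C1 : copula_process n x y u v = Num.sqrt n%:R * (n%:R^-1 * Nab - u * v).
  rewrite /copula_process powR12_sqrt// /empirical_copula /ecdf2.
  congr (_ * (_ * _ - _)); apply: eq_bigr => i _.
  by rewrite aE// bE.
have C2 : alpha n (G \o x) (H \o y) u v = Num.sqrt n%:R * (n%:R^-1 * Nuv - u * v).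
  by rewrite /alpha powR12_sqrt.
have C3 : alphaV n (G \o x) (H \o y) v = Num.sqrt n%:R * (n%:R^-1 * Nv - v).
  rewrite /alphaV /alpha powR12_sqrt// /uniform_ecdf mul1r.
  congr (_ * (_ * _ - _)); apply: eq_bigr => i _ /=.
  by have /andP[_ ->] := G01 i.
have C4 : alphaU n (G \o x) (H \o y) u = Num.sqrt n%:R * (n%:R^-1 * Nu - u).
  rewrite /alphaU /alpha powR12_sqrt// /uniform_ecdf mulr1.
  congr (_ * (_ * _ - _)); apply: eq_bigr => i _ /=.
  by have /andP[_ ->] := H01 i; rewrite andbT.
have -> : copula_process n x y u v - alpha n (G \o x) (H \o y) u v
      + u * alphaV n (G \o x) (H \o y) v + v * alphaU n (G \o x) (H \o y) u =
   (Num.sqrt n%:R)^-1 * (cross_sum U V n u a v b w + u * (Nb - n%:R * v) + v * (Na - n%:R * u)).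
  rewrite C1 C2 C3 C4 ZE; move: (Num.sqrt n%:R) sn0 snn {C1 C2 C3 C4 ZE} => sn sn0 <-.
  by field; rewrite gt_eqF.
rewrite normrM ger0_norm ?invr_ge0 ?(ltW sn0)// ler_pM2l ?invr_gt0//.
rewrite -addrA (le_trans (ler_normD _ _))// lerD2l (le_trans (ler_normD _ _))//.
case/andP: u01 => u0 u1; case/andP: v01 => v0 v1.
rewrite (_ : 2 = 1 + 1)// lerD// normrM ger0_norm// mulr_ile1//.
Qed.

End copula_identity.
(** * The almost sure bound *)

Section copula_ae.
Context (R : realType) (d : measure_display) (T : measurableType d)
  (P : probability T R)
  (X Y : {RV P >-> R}) (Xs Ys : nat -> {RV P >-> R})
  (hXY : independent_RVs P X Y)
  (hG : continuous (cdf X)) (hH : continuous (cdf Y))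
  (hlaw : forall i, same_law P (fun w => (Xs i w, Ys i w))
                               (fun w => (X w, Y w)))
  (hind : mutually_independent P (fun i w => (Xs i w, Ys i w))).

Let G := fun s => fine (cdf X s).
Let H := fun t => fine (cdf Y t).
Let U i w := G (Xs i w).
Let V i w := H (Ys i w).

(** The budget is 4.47 * 1.01 + 20/250 = 4.5947: rounding enlarges the variance by one percent, and
    the lower bound on l makes y^5 at most 1/250 of the main term. *)
Lemma oscillation_error_le (y L l n sigma : R) :
  0 < sigma -> 1 <= y -> 1 <= l -> n = y ^+ 20 -> l <= L ->
  250%:R * 250%:R / sigma <= l ->
  447%:R / 100%:R * Num.sqrt (101%:R / 100%:R * sigma * (Num.sqrt (n * l) * L))
    + 18%:R * y ^+ 5 + 2 <= 46%:R / 10%:R * Num.sqrt (sigma * (Num.sqrt (n * l) * L)).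
Proof.
move=> sigma0 y1 l1 nE lL hl.
have y0 : 0 < y by lra.
have q_ge : y ^+ 10 <= Num.sqrt (n * l).
  rewrite -[leLHS]ger0_norm ?exprn_ge0 ?(ltW y0)// -sqrtr_sqr ler_wsqrtr//.
  by rewrite nE -exprM ler_peMr// exprn_ge0// ltW.
set q := Num.sqrt (n * l) in q_ge *.
have q0 : 0 < q by apply: lt_le_trans q_ge; rewrite exprn_gt0.
have A1 : 2 * Num.sqrt (101%:R / 100%:R * sigma * (q * L))
    <= 202%:R / 100%:R * Num.sqrt (sigma * (q * L)).
  apply: double_sqrt_le; first by lra.
  have : 0 <= sigma * (q * L) by rewrite !mulr_ge0 ?(ltW sigma0) ?(ltW q0)//; lra.
  rewrite -mulrA; move: (sigma * _) => z; lra.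
have A2 : 2 * Num.sqrt (y ^+ 10) <= 1 / 125%:R * Num.sqrt (sigma * (q * L)).
  apply: double_sqrt_le; first by lra.
  have h : 250%:R * 250%:R <= sigma * L.
    by move: hl; rewrite ler_pdivrMr// => h; apply: (le_trans h); rewrite mulrC ler_pM2l.
  have : 250%:R * 250%:R * y ^+ 10 <= sigma * L * q.
    apply: ler_pM h q_ge; last by rewrite exprn_ge0 ?(ltW y0).
    by rewrite -natrM ler0n.
  lra.
have -> : y ^+ 5 = Num.sqrt (y ^+ 10).
  by rewrite (_ : y ^+ 10 = (y ^+ 5) ^+ 2) ?sqrtr_sqr ?ger0_norm ?exprn_ge0 ?(ltW y0) -?exprM.
have A3 : 1 <= Num.sqrt (y ^+ 10) by rewrite -[leLHS]sqrtr1 ler_wsqrtr// exprn_ege1.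
lra.
Qed.

(** As a solves the quantile equation up to 1, the iterated logarithm at a bounds n |a - u| by 1.3
    (n l)^(1/2) + 1. The spare 0.01 absorbs this 1 and the rounding, at most n / M <= y^5. *)
Lemma window_floor (y l n M u a c c' S : R) :
  1 <= y -> 1 <= l -> n = y ^+ 20 -> 400%:R <= y -> y ^+ 15 <= M ->
  `|S| <= 13%:R / 10%:R * Num.sqrt (n * l) ->
  `|S + n * (a - u)| <= 1 ->
  0 <= u - c <= M^-1 -> 0 <= a - c' <= M^-1 ->
  `|c' - c| <= 131%:R / 100%:R * Num.sqrt (l / n).
Proof.
move=> y1 l1 nE y400 yM hS hSa /andP[c0 c1] /andP[c0' c1'].
have y0 : 0 < y by lra.
have n0 : 0 < n by rewrite nE exprn_gt0.
have q_ge : y ^+ 10 <= Num.sqrt (n * l).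
  rewrite -[leLHS]ger0_norm ?exprn_ge0 ?(ltW y0)// -sqrtr_sqr ler_wsqrtr//.
  by rewrite nE -exprM ler_peMr// exprn_ge0// ltW.
have qE : n * Num.sqrt (l / n) = Num.sqrt (n * l).
  rewrite -[X in X * _]ger0_norm ?(ltW n0)// -sqrtr_sqr -sqrtrM ?sqr_ge0//.
  by congr Num.sqrt; field; rewrite gt_eqF.
have M0 : 0 < M by apply: lt_le_trans yM; rewrite exprn_gt0.
have nM : n * M^-1 <= y ^+ 5.
  rewrite ler_pdivrMr// nE (_ : y ^+ 20 = y ^+ 5 * y ^+ 15); last by rewrite -exprD.
  by rewrite ler_pM2l// exprn_gt0.
have h5 : 400%:R * y ^+ 5 <= y ^+ 10.
  rewrite (_ : y ^+ 10 = y ^+ 5 * y ^+ 5); last by rewrite -exprD.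
  rewrite ler_pM2r ?exprn_gt0//.
  by rewrite (le_trans y400)// -[leLHS]expr1 ler_weXn2l.
have h51 : 1 <= y ^+ 5 by rewrite exprn_ege1.
rewrite -(ler_pM2l n0) (_ : n * (131%:R / 100%:R * _) =
  131%:R / 100%:R * (n * Num.sqrt (l / n))); last by ring.
rewrite qE -[X in X * _]ger0_norm ?(ltW n0)// -normrM.
have e1 : n * (u - c) <= n * M^-1 by rewrite ler_wpM2l// ltW.
have e2 : n * (a - c') <= n * M^-1 by rewrite ler_wpM2l// ltW.
have e3 : 0 <= n * (u - c) by rewrite mulr_ge0// ltW.
have e4 : 0 <= n * (a - c') by rewrite mulr_ge0// ltW.
move: hS hSa; rewrite !ler_norml => /andP[? ?] /andP[? ?]; apply/andP; split; lra.
Qed.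

(** Moving t down by r raises t (1 - t) by at most r, and the grid step is at most sigma / 100. *)
Lemma variance_floor (u c M y sigma : R) : 1 <= y -> 0 < sigma ->
  100%:R / sigma <= y -> y ^+ 15 <= M ->
  0 <= u <= 1 -> 0 <= u - c <= M^-1 -> u * (1 - u) <= sigma ->
  c * (1 - c) <= 101%:R / 100%:R * sigma.
Proof.
move=> y1 s0 ys yM /andP[u0 u1] /andP[c0 c1] us.
have M1 : M^-1 <= sigma / 100%:R.
  rewrite -[sigma / _]invrK lef_pV2 ?posrE ?invr_gt0 ?divr_gt0//.
    rewrite invf_div (le_trans ys)// (le_trans _ yM)//.
    by rewrite -[leLHS]expr1 ler_weXn2l.
  by apply: lt_le_trans yM; rewrite exprn_gt0//; lra.
nra.
Qed.

Lemma scale_bounds (y L l sigma : R) : 0 < sigma -> 1 <= l -> l <= L ->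
  (400%:R + 100%:R / sigma) * L ^+ 2 <= y ->
  [/\ 0 < y, 400%:R <= y & 100%:R / sigma <= y].
Proof.
move=> sigma0 l1 lL Ky.
have s0 : 0 < 100%:R / sigma by rewrite divr_gt0.
have LL : 1 <= L ^+ 2 by rewrite exprn_ege1//; lra.
have : 400%:R + 100%:R / sigma <= y.
  apply: le_trans Ky; apply: ler_peMr LL.
  exact: addr_ge0 (ler0n _ _) (ltW s0).
by clear Ky; move=> h; split; lra.
Qed.

Lemma copula_process_ae (sigma : R) : 0 < sigma ->
  {ae P, forall w, \forall n \near \oo, forall u v : R,
     0 <= u <= 1 -> 0 <= v <= 1 -> u * (1 - u) <= sigma -> v * (1 - v) <= sigma ->
    `|copula_process n (Xs ^~ w) (Ys ^~ w) u v
      - alpha n (G \o Xs ^~ w) (H \o Ys ^~ w) u v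
      + u * alphaV n (G \o Xs ^~ w) (H \o Ys ^~ w) v
      + v * alphaU n (G \o Xs ^~ w) (H \o Ys ^~ w) u|
    <= (Num.sqrt n%:R)^-1 *
       (46%:R / 10%:R * Num.sqrt (sigma * osc_rate R n))}.
Proof.
move=> sigma0.
have mG := measurable_fine_cdf X; have mH := measurable_fine_cdf Y.
have PG := probability_integral_transform hG.
have PH := probability_integral_transform hH.
have mG2 := measurable_fst_le mG; have mH2 := measurable_snd_le mH.
have hU : forall u a : R, 0 <= u <= 1 -> 0 <= a <= 1 ->
    iid_words P (fun i w => cell u a (U i w)) (cell_prob u a).
  by move=> u a; exact: (iid_words_cell hlaw hind mG2 PG).
have hV : forall u a : R, 0 <= u <= 1 -> 0 <= a <= 1 ->
    iid_words P (fun i w => cell u a (V i w)) (cell_prob u a).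
  by move=> u a; exact: (iid_words_cell hlaw hind mH2 PH).
have U0 := ae_coordinate_gt0 hlaw mG2 PG.
have V0 := ae_coordinate_gt0 hlaw mH2 PH.
have Und := ae_coordinate_neq hlaw hind mG2 PG.
have Vnd := ae_coordinate_neq hlaw hind mH2 PH.
have lilU := lil_centered_count hU; have lilV := lil_centered_count hV.
have incU := grid_increment_ae hU; have incV := grid_increment_ae hV.
have sigma0' : 0 < 101%:R / 100%:R * sigma by rewrite mulr_gt0.
have osc := oscillation_grid_ae sigma0' (fun u a v b =>
  @iid_words_cell2 _ _ _ _ X Y Xs Ys hXY hlaw hind G H mG mH PG PH u a v b).
apply: filterS (filterI (filterI U0 V0) (filterI (filterI Und Vnd)
  (filterI (filterI lilU lilV) (filterI (filterI incU incV) osc)))).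
move=> w [[U0w V0w] [[Undw Vndw] [[lilUw lilVw] [[incUw incVw] oscw]]]].
apply: filterS (filterI (filterI lilUw lilVw) (filterI (filterI incUw incVw)
  (filterI oscw (filterI (near_scale (400%:R + 100%:R / sigma))
  (filterI (near_lnln (250%:R * 250%:R / sigma)) (nbhs_infty_ge 1)))))).
move=> n [[lU lV] [[iU iV] [os [[nE l1 lL y1 Ky] [hl n0]]]]].
move=> u v u01 v01 us vs.
set L := ln n%:R in nE l1 lL y1 Ky hl lU lV iU iV.
set y := expR (L / 20) in nE y1 Ky iU iV.
have /andP[/ltW M1 M2] := grid_size_itv R n; rewrite -/L -/y in M1 M2.
have [y0 y400 ys] := scale_bounds sigma0 l1 lL Ky.
have M0 : 0 < (grid_size R n)%:R :> R by rewrite ltr0n.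
have nM : n%:R / (grid_size R n)%:R <= y ^+ 5.
  rewrite ler_pdivrMr// nE (_ : y ^+ 20 = y ^+ 5 * y ^+ 15); last by rewrite -exprD.
  by rewrite ler_pM2l// exprn_gt0.
have G01 i : 0 < G (Xs i w) <= 1.
  by rewrite U0w; have /andP[] := fine_cdf_itv X (Xs i w).
have H01 i : 0 < H (Ys i w) <= 1.
  by rewrite V0w; have /andP[] := fine_cdf_itv Y (Ys i w).
have [a [b [[a01 b01] Sa Sb appr]]] := @copula_process_approx _ _ _ n (Xs ^~ w) (Ys ^~ w) G H
  U V w u v n0 u01 v01 (@fine_cdf_nd _ _ _ _ X) (@fine_cdf_nd _ _ _ _ Y) G01 H01 Undw Vndw
  (fun=> erefl) (fun=> erefl).
have [i [i' [l [l' [hM [ui ai] [vl bl] dist]]]]] :=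
  cross_sum_floor (ltn0Sn _ : (0 < grid_size R n)%N) nM iU iV u01 a01 v01 b01.
have {os} os := os i i' l l' hM (variance_floor y1 sigma0 ys M1 u01 ui us)
  (variance_floor y1 sigma0 ys M1 v01 vl vs)
  (window_floor y1 l1 nE y400 M1 (lU a a01) Sa ui ai)
  (window_floor y1 l1 nE y400 M1 (lV b b01) Sb vl bl).
apply: (le_trans appr); apply: ler_wpM2l; first by rewrite invr_ge0 sqrtr_ge0.
apply: le_trans (oscillation_error_le sigma0 y1 l1 nE lL hl).
rewrite lerD2r.
have := le_trans (lerB_dist _ _) dist; rewrite lerBlDl => /le_trans; apply.
by rewrite lerD2r.
Qed.

End copula_ae.

(** * Normalization and numerical constants *)

Section normalization.
Context (R : realType).

Lemma limn_esup_le_near (f : nat -> \bar R) (b : \bar R) :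
  (\forall n \near \oo, (f n <= b)%E) -> (limn_esup f <= b)%E.
Proof.
move=> h; rewrite /limn_esup /limf_esup; apply: ge_ereal_inf.
exists (ereal_sup (f @` [set n | (f n <= b)%E])); first by exists [set n | (f n <= b)%E].
by apply: ge_ereal_sup => _ [n /= fn <-].
Qed.

Lemma powR4X (a : R) : 0 <= a -> (a `^ 4^-1) ^+ 4 = a.
Proof.
by move=> a0; rewrite -powR_mulrn ?powR_ge0// -powRrM mulVf// powRr1.
Qed.

Lemma sqrt_sqrtE (a : R) : 0 <= a -> Num.sqrt (Num.sqrt a) = a `^ 4^-1.
Proof.
move=> a0; rewrite -!powR12_sqrt ?powR_ge0// -powRrM; congr (_ `^ _).
by field.
Qed.

Lemma supnorm_le (f : R -> R -> R) (B : R) :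
  (forall u v, 0 <= u <= 1 -> 0 <= v <= 1 -> `|f u v| <= B) ->
  (supnorm f <= B%:E)%E.
Proof.
move=> h; apply: ge_ereal_sup => _ [u /= u01 [v /= v01 <-]].
by rewrite lee_fin h// -[_ && _]/(_ \in `[0, 1]%R).
Qed.

Lemma log12E (n : R) : 1 <= ln (ln n) ->
  log1 n = ln n /\ Defs.log2 n = ln (ln n).
Proof.
move=> l1.
have L0 : 0 < ln n.
  by rewrite ltNge; apply/negP => L0; rewrite ln0// in l1; lra.
have eL : expR 1 <= ln n by rewrite -[leRHS]lnK ?posrE// ler_expR.
have n0 : 0 < n by rewrite ltNge; apply/negP => n0; rewrite ln0 ?ltxx in L0.
have L1 : 1 <= ln n by apply: le_trans eL; have := expR_ge1Dx (1 : R); lra.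
have en : expR 1 <= n by rewrite -[leRHS]lnK ?posrE// ler_expR.
have E1 : log1 n = ln n by rewrite /log1 max_l.
by rewrite /Defs.log2 E1 /log1 max_l.
Qed.

(** The powers of l and L cancel, and what remains is (n / k)^(1/4), at most gamma^(-1/4); this is
    where gamma > 0 enters. *)
Lemma normalization_le (n k l L sigma gamma : R) :
  0 < n -> 0 < gamma -> gamma <= k / n -> 0 < l -> 0 < L -> 0 < sigma ->
  n `^ 2^-1 * k `^ (- 4^-1) * l `^ (- 4^-1) * L `^ (- 2^-1) *
    ((Num.sqrt n)^-1 * (46%:R / 10%:R * Num.sqrt (sigma * (Num.sqrt (n * l) * L))))
  <= 46%:R / 10%:R * Num.sqrt sigma * (gamma `^ 4^-1)^-1.
Proof.
move=> n0 g0 gk l0 L0 s0.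
have kgn : gamma * n <= k by rewrite -ler_pdivlMr.
have gn0 : 0 < gamma * n by rewrite mulr_gt0.
have k0 : 0 < k by apply: lt_le_trans kgn.
rewrite !powRN !powR12_sqrt ?(ltW n0) ?(ltW L0)//.
rewrite sqrtrM ?(ltW s0)// sqrtrM ?sqrtr_ge0// sqrt_sqrtE ?mulr_ge0 ?(ltW n0) ?(ltW l0)//.
rewrite powRM ?(ltW n0) ?(ltW l0)//.
have : (gamma * n) `^ 4^-1 <= k `^ 4^-1.
  by rewrite ge0_ler_powR ?invr_ge0 ?nnegrE ?(ltW gn0) ?(ltW k0).
rewrite powRM ?(ltW g0) ?(ltW n0)//.
have := powR_gt0 4^-1 n0; have := powR_gt0 4^-1 l0; have := powR_gt0 4^-1 k0.
have := powR_gt0 4^-1 g0.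
have : 0 < Num.sqrt n by rewrite sqrtr_gt0.
have : 0 < Num.sqrt L by rewrite sqrtr_gt0.
have : 0 < Num.sqrt sigma by rewrite sqrtr_gt0.
move: (Num.sqrt n) (Num.sqrt L) (Num.sqrt sigma).
move: (n `^ 4^-1) (l `^ 4^-1) (k `^ 4^-1) (gamma `^ 4^-1).
move=> n4 l4 k4 g4 sn sL ss ss0 sL0 sn0 g40 k40 l40 n40 h.
have -> : sn * k4^-1 * l4^-1 * sL^-1 * (sn^-1 * (46%:R / 10%:R * (ss * (n4 * l4 * sL)))) =
  46%:R / 10%:R * ss * (n4 / k4).
  by field; rewrite !gt_eqF.
apply: ler_wpM2l; first by rewrite mulr_ge0// ltW.
by rewrite ler_pdivrMr// mulrC ler_pdivlMr// mulrC.
Qed.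

(** With m = (2 gamma (1 - gamma))^(1/4), the claim becomes a bound of about 4.623 m by 3 + 2^(3/2)
    gamma. *)
Lemma constant_small_gamma (gamma : R) : 0 < gamma -> gamma <= 2^-1 ->
  46%:R / 10%:R * Num.sqrt (101%:R / 100%:R * (gamma * (1 - gamma))) * (gamma `^ 4^-1)^-1
  <= (3 * 2 `^ (- 4^-1) + gamma * 2 `^ (5 / 4)) * (1 - gamma) `^ 4^-1.
Proof.
move=> g0 g12.
have h0 : 0 < 1 - gamma by lra.
have -> : 2 `^ (5 / 4) = 2 * 2 `^ 4^-1 :> R.
  have -> : 5 / 4 = 1 + 4^-1 :> R by field.
  by rewrite powRD ?powRr1//; apply/implyP => _; rewrite pnatr_eq0.
rewrite powRN.
have := powR4X (ltW g0); have := powR4X (ltW h0); have := powR4X (ler0n R 2).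
have := powR_gt0 4^-1 g0; have := powR_gt0 4^-1 h0; have := powR_gt0 4^-1 (ltr0n R 2).
move: (2 `^ 4^-1) ((1 - gamma) `^ 4^-1) (gamma `^ 4^-1) => t h g t0 hp gp t4 h4 g4.
have sq : Num.sqrt (101%:R / 100%:R * (gamma * (1 - gamma)))
    <= 201%:R / 200%:R * (g ^+ 2 * h ^+ 2).
  rewrite -[leRHS]ger0_norm; last by rewrite !mulr_ge0// ?exprn_ge0// ltW.
  rewrite -sqrtr_sqr; apply: ler_wsqrtr.
  have -> : (201%:R / 200%:R * (g ^+ 2 * h ^+ 2)) ^+ 2 =
    (201%:R / 200%:R) ^+ 2 * (g ^+ 4 * h ^+ 4) by field.
  rewrite g4 h4; apply: ler_wpM2r; last by lra.
  by rewrite mulr_ge0// ltW.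
apply: (@le_trans _ _ (46%:R / 10%:R * (201%:R / 200%:R * (g ^+ 2 * h ^+ 2)) * g^-1)).
  by apply: ler_wpM2r; [rewrite invr_ge0 ltW|apply: ler_wpM2l => //; lra].
have -> : 46%:R / 10%:R * (201%:R / 200%:R * (g ^+ 2 * h ^+ 2)) * g^-1 =
   46%:R / 10%:R * (201%:R / 200%:R) * (g * h) * h by field; rewrite gt_eqF.
rewrite ler_pM2r//.
have -> : 3 / t + gamma * (2 * t) = (3 + 2 * t ^+ 2 * gamma) / t by field; rewrite gt_eqF.
rewrite ler_pdivlMr//.
have tt : (t ^+ 2) ^+ 2 = 2 by rewrite -exprM t4.
have t2 : 7%:R / 5%:R <= t ^+ 2.
  rewrite leNgt; apply/negP => tlt.
  have : 0 <= t ^+ 2 by rewrite sqr_ge0.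
  by move: tt tlt; move: (t ^+ 2) => z; nra.
pose m := g * h * t.
have m0 : 0 <= m by rewrite !mulr_ge0// ltW.
have m4 : (m ^+ 2) ^+ 2 = 2 * (gamma * (1 - gamma)).
  by rewrite -t4 -h4 -g4 /m; ring.
have z0 : 0 <= m ^+ 2 by rewrite sqr_ge0.
(* Tangent to the square root at m^2 = 3/5, that is near gamma = 0.235, where there is little room;
   what remains is quadratic in gamma. *)
have zle : m ^+ 2 <= gamma * (1 - gamma) * 5%:R / 3%:R + 3%:R / 10%:R.
  have := sqr_ge0 (m ^+ 2 - 3%:R / 5%:R); rewrite sqrrB m4; lra.
have -> : 46%:R / 10%:R * (201%:R / 200%:R) * (g * h) * t =
   46%:R / 10%:R * (201%:R / 200%:R) * m by rewrite /m; ring.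
apply: (@le_trans _ _ (3 + 14%:R / 5%:R * gamma)); last first.
  have : 7%:R / 5%:R * gamma <= t ^+ 2 * gamma by rewrite ler_pM2r.
  lra.
rewrite -(@ler_pXn2r _ 2)// ?nnegrE; last 2 first.
- by apply: mulr_ge0 m0; lra.
- lra.
rewrite exprMn.
(* 43/200 is close to the minimizer of the remaining quadratic; the square is a hint for [nra]. *)
have q := sqr_ge0 (gamma - 43%:R / 200%:R).
move: z0 zle q; move: (m ^+ 2) => z z0 zle q.
apply: (@le_trans _ _ ((46%:R / 10%:R * (201%:R / 200%:R)) ^+ 2 *
  (gamma * (1 - gamma) * 5%:R / 3%:R + 3%:R / 10%:R))).
  by rewrite ler_wpM2l// sqr_ge0.
nra.
Qed.

(** The bracket increases with gamma, so 1/2 is the worst case: there 3 * 1.1 / 2 + 1.54 / 2 = 2.42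
    already exceeds 2.3. *)
Lemma constant_large_gamma (gamma : R) : 2^-1 < gamma ->
  46%:R / 10%:R * Num.sqrt 4^-1 * (gamma `^ 4^-1)^-1
  <= (3 * 2 `^ (- (3 / 4)) + gamma * 2 `^ (3 / 4)) * gamma `^ (- 4^-1).
Proof.
move=> g12.
have g0 : 0 < gamma by lra.
rewrite (powRN gamma) ler_pM2r ?invr_gt0 ?powR_gt0// powRN.
have -> : 2 `^ (3 / 4) = (2 `^ 4^-1) ^+ 3 :> R.
  by rewrite -powR_mulrn ?powR_ge0// -powRrM mulrC.
have -> : Num.sqrt 4^-1 = 2^-1 :> R.
  by rewrite (_ : 4^-1 = 2^-1 ^+ 2) ?sqrtr_sqr ?ger0_norm//; field.
have := powR4X (ler0n R 2).
have := powR_gt0 4^-1 (ltr0n R 2).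
move: (2 `^ 4^-1) => t t0 t4.
have tt : (t ^+ 2) ^+ 2 = 2 by rewrite -exprM t4.
have t2 : 7%:R / 5%:R <= t ^+ 2.
  rewrite leNgt; apply/negP => tlt.
  have : 0 <= t ^+ 2 by rewrite sqr_ge0.
  by move: tt tlt; move: (t ^+ 2) => z; nra.
have t1 : 11%:R / 10%:R <= t by nra.
have -> : (t ^+ 3)^-1 = t / 2.
  by rewrite -t4; field; rewrite gt_eqF.
have t3 : 154%:R / 100%:R <= t ^+ 3.
  rewrite exprSr (_ : 154%:R / 100%:R = 7%:R / 5%:R * (11%:R / 10%:R)); last by field.
  by apply: ler_pM => //; rewrite ?divr_ge0.
have : 2^-1 * (154%:R / 100%:R) <= gamma * t ^+ 3.
  by apply: ler_pM => //; rewrite ?divr_ge0// ltW.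
lra.
Qed.

End normalization.

(** The levels u k_n / n stay below k_n / n, so sigma only has to bound t (1 - t) up to there; the
    two ranges of gamma differ only in the choice of sigma. *)
Lemma normalized_error_ae (R : realType) (d : measure_display)
  (T : measurableType d) (P : probability T R)
  (X Y : {RV P >-> R}) (Xs Ys : nat -> {RV P >-> R})
  (hXY : independent_RVs P X Y)
  (hG : continuous (cdf X)) (hH : continuous (cdf Y))
  (hlaw : forall i, same_law P (fun w => (Xs i w, Ys i w))
                               (fun w => (X w, Y w)))
  (hind : mutually_independent P (fun i w => (Xs i w, Ys i w)))
  (k : nat -> R) (gamma sigma : R) :
  0 < gamma -> 0 < sigma ->
  (\forall n \near \oo, gamma <= k n / n%:R <= 1 /\
    forall t, 0 <= t -> t <= k n / n%:R -> t * (1 - t) <= sigma) ->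
  {ae P, forall w,
    (limn_esup (normalized_error k (fun s => fine (cdf X s))
       (fun t => fine (cdf Y t)) (Xs ^~ w) (Ys ^~ w)) <=
     (46%:R / 10%:R * Num.sqrt sigma * (gamma `^ 4^-1)^-1)%:E)%E}.
Proof.
move=> g0 s0 hk.
apply: filterS (copula_process_ae hXY hG hH hlaw hind s0) => w hw.
apply: limn_esup_le_near.
apply: filterS (filterI hw (filterI hk (filterI (near_lnln (1 : R)) (nbhs_infty_ge 1)))).
move=> n [H [[/andP[gk k1] ks] [l1 n1]]].
have n0 : 0 < n%:R :> R by rewrite ltr0n.
have [E1 E2] := log12E l1.
have L0 : 0 < ln n%:R :> R.
  by rewrite ltNge; apply/negP => L0; move: l1; rewrite ln0 ?ler10.
have kn0 : 0 < k n / n%:R by apply: lt_le_trans gk.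
rewrite /normalized_error E1 E2.
have scaled u : 0 <= u <= 1 -> 0 <= u * (k n / n%:R) <= 1 /\
    u * (k n / n%:R) * (1 - u * (k n / n%:R)) <= sigma.
  move=> /andP[u0 u1].
  have a0 : 0 <= u * (k n / n%:R) by rewrite mulr_ge0// ltW.
  have ak : u * (k n / n%:R) <= k n / n%:R by rewrite ler_piMl// ltW.
  by split; [rewrite a0 (le_trans ak)|exact: ks].
have c0 : 0 <= n%:R `^ 2^-1 * k n `^ (- 4^-1) * ln (ln n%:R) `^ (- 4^-1)
    * ln n%:R `^ (- 2^-1) :> R.
  by rewrite !mulr_ge0// powR_ge0.
have S : (supnorm (fun u v => local_copula_process n (Xs ^~ w) (Ys ^~ w) (k n) u v
      - local_alpha0 n ((fun s => fine (cdf X s)) \o Xs ^~ w)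
          ((fun s => fine (cdf Y s)) \o Ys ^~ w) (k n) u v)%R
    <= ((Num.sqrt n%:R)^-1 *
       (46%:R / 10%:R * Num.sqrt (sigma * osc_rate R n)))%:E)%E.
  apply: supnorm_le => u v /scaled[u01 us] /scaled[v01 vs].
  apply: le_trans (H _ _ u01 v01 us vs).
  rewrite le_eqVlt; apply/orP; left; apply/eqP; congr (`|_|).
  by rewrite /local_copula_process /local_alpha0; ring.
apply: le_trans (lee_wpmul2l _ S) _; first by rewrite lee_fin.
by rewrite -EFinM lee_fin /osc_rate; apply: normalization_le => //; lra.
Qed.

Theorem theorem2p1 (R : realType) (d : measure_display) (T : measurableType d)
  (P : probability T R)
  (X Y : {RV P >-> R}) (Xs Ys : nat -> {RV P >-> R})
  (hXY : independent_RVs P X Y)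
  (hG : continuous (cdf X)) (hH : continuous (cdf Y))
  (hlaw : forall i, same_law P (fun w => (Xs i w, Ys i w))
                               (fun w => (X w, Y w)))
  (hind : mutually_independent P (fun i w => (Xs i w, Ys i w)))
  (k : nat -> R) (gamma : R)
  (hkpos : forall n, (0 < n)%N -> 0 < k n)
  (hkle : forall n, (1 < n)%N -> k n <= n%:R)
  (hkmono : forall m n, (1 < m)%N -> (m <= n)%N -> k m <= k n)
  (hkn_mono : forall m n, (1 < m)%N -> (m <= n)%N ->
     k n / n%:R <= k m / m%:R)
  (hkn_lim : k n / n%:R @[n --> \oo] --> gamma)
  (hgamma : 0 <= gamma <= 1)
  (hklog : k n / log2 n%:R @[n --> \oo] --> +oo) :
  let G := fun s => fine (cdf X s) in
  let H := fun t => fine (cdf Y t) in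
  \forall w \ae P,
    (0 < gamma <= 2^-1 ->
      (limn_esup (normalized_error k G H (Xs ^~ w) (Ys ^~ w)) <=
       ((3 * 2 `^ (- 4^-1) + gamma * 2 `^ (5 / 4))
        * (1 - gamma) `^ 4^-1)%:E)%E) /\
    (2^-1 < gamma <= 1 ->
      (limn_esup (normalized_error k G H (Xs ^~ w) (Ys ^~ w)) <=
       ((3 * 2 `^ (- (3 / 4)) + gamma * 2 `^ (3 / 4))
        * gamma `^ (- 4^-1))%:E)%E).
Proof.
move=> G H.
have near_ratio (e : R) : 0 < e -> 0 < gamma -> \forall n \near \oo,
    gamma <= k n / n%:R <= 1 /\ k n / n%:R <= gamma + e.
  move=> e0 g0; near=> n.
  have n1 : (1 < n)%N by near: n; exact: nbhs_infty_ge.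
  have nR : 0 < n%:R :> R by rewrite ltr0n ltnW.
  split; last first.
    by apply: ltW; near: n; apply: (cvgr_lt _ hkn_lim); rewrite ltrDl.
  rewrite ler_pdivrMr// mul1r hkle// andbT.
  (* The ratios are nonincreasing: one value below gamma would keep the limit below gamma. *)
  rewrite leNgt; apply/negP => kg.
  have [m _ hm] := cvgr_gt _ hkn_lim _ kg.
  have := hm (maxn m n) (leq_maxl _ _).
  by rewrite /= ltNge hkn_mono// leq_maxr.
have [/andP[g0 g12]|gs] := boolP (0 < gamma <= 2^-1).
  have gg : 0 < gamma * (1 - gamma) by rewrite mulr_gt0//; lra.
  (* k_n / n approaches gamma from above, so the variance may slightly exceed gamma (1 - gamma); one
     percent is allowed for it. *)
  have s0 : 0 < 101%:R / 100%:R * (gamma * (1 - gamma)) by rewrite mulr_gt0.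
  have := normalized_error_ae hXY hG hH hlaw hind g0 s0 (k := k).
  move=> main; apply: filterS (main _) => [w hw|]; last first.
    have e0 : 0 < gamma * (1 - gamma) / 100%:R by rewrite divr_gt0.
    apply: filterS (near_ratio _ e0 g0) => n [-> ke]; split => // t t0 tk.
    nra.
  split => [_|/andP[g12']]; last by rewrite ltNge g12 in g12'.
  by apply: le_trans hw _; rewrite lee_fin constant_small_gamma.
have [/andP[g12 g1]|gl] := boolP (2^-1 < gamma <= 1).
  have g0 : 0 < gamma by lra.
  (* For gamma > 1/2 the interval [0, k_n / n] contains the point 1/2, where t (1 - t) has its
     maximum 1/4. *)
  have s0 : 0 < 4^-1 :> R by rewrite invr_gt0.
  have := normalized_error_ae hXY hG hH hlaw hind g0 s0 (k := k).
  move=> main; apply: filterS (main _) => [w hw|]; last first.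
    apply: filterS (near_ratio 1 ltr01 g0) => n [-> ke]; split => // t t0 tk.
    have := sqr_ge0 (t - 2^-1); nra.
  split => // _; apply: le_trans hw _.
  by rewrite lee_fin constant_large_gamma.
(* Only gamma = 0 is left, and both implications are vacuous. *)
by apply: aeW => w; split.
Unshelve. all: by end_near. Qed.
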